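(* (1) If $\kappa$ is the first (strongly) inaccessible cardinal, then $\mathrm{HL}^+_{2,\theta}[\kappa]$ fails for each $2\le\theta<\kappa$. (2) If $\kappa$ is (strongly) inaccessible and not Mahlo, then $\mathrm{HL}^+_{2,\theta}[\kappa]$ fails for each $2\le\theta<\kappa$. (3) If $\kappa$ is a singular strong limit cardinal with $\mathrm{cf}(\kappa)=\mu^+$, where $\mu$ is a regular cardinal, then $\mathrm{HL}^+_{2,\mu^+}[\kappa]$ fails.
   Context: Notation: ${}^{\kappa>}2=\bigcup_{\alpha<\kappa}{}^{\alpha}2$; $\mathrm{lg}(\eta)$ is the length of $\eta$; $\eta\trianglelefteq\nu$ means $\eta$ is an initial segment of $\nu$, and $\eta\triangleleft\nu$ means a proper initial segment. A subtree $T\subseteq{}^{\kappa>}2$ (nonempty, closed under initial segments) is regular if (1) for all $\eta\in T$ and $\alpha<\kappa$ there is $\nu\in T$ with $\eta\trianglelefteq\nu$ and $\mathrm{lg}(\nu)=\max\{\mathrm{lg}(\eta),\alpha\}$, and (2) whenever $\delta<\kappa$ is a limit and $\eta\in{}^{\delta}2$ has $\eta\restriction\alpha\in T$ for all $\alpha<\delta$, then $\eta\in T$. A triple $(\kappa,T,A)$ is suitable if $A\in[\kappa]^\kappa$, $T$ is a regular subtree of ${}^{\kappa>}2$, and for $\eta\in T\cap{}^{\alpha}2$: $\{\eta^\frown0,\eta^\frown1\}\subseteq T$ iff $\alpha\in A$. $\mathrm{HL}^+_{n,\theta}[\kappa]$ is the statement: for every sequence $\langle<_\alpha:\alpha<\kappa\rangle$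 with $<_\alpha$ a well-ordering of ${}^{\alpha}2$ and every coloring $c:\bigcup\{[{}^{\alpha}2]^n:\alpha<\kappa\}\to\theta$, there is a suitable triple $(\kappa,T,A)$ such that whenever $\alpha<\kappa$ and $\eta_0,\dots,\eta_{n-1}\in T\cap{}^{\alpha}2$ are pairwise distinct, $c$ omits at least one color (i.e., its range is not all of $\theta$) on the set of (sets formed by) tuples $(\nu_0,\dots,\nu_{n-1})$ with $\eta_\ell\triangleleft\nu_\ell\in T$ for all $\ell<n$, $\mathrm{lg}(\nu_0)=\dots=\mathrm{lg}(\nu_{n-1})\in A$, and $\nu_0<_{\mathrm{lg}(\nu_0)}\nu_1<_{\mathrm{lg}(\nu_0)}\dots<_{\mathrm{lg}(\nu_0)}\nu_{n-1}$. *)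

(* Defs.v *)
From mathcomp Require Import all_boot all_order.
From mathcomp Require Import boolp classical_sets functions cardinality wochoice.

Set Implicit Arguments.
Unset Strict Implicit.
Unset Printing Implicit Defensive.

Import Order.TTheory.
Local Open Scope classical_set_scope.
Local Open Scope card_scope.
Local Open Scope order_scope.

(* The ordinal kappa is a well-ordered type K : orderType d.  An ordinal       *)
(* alpha < kappa is an element a : K, standing for its initial segment         *)
(* {x | x < a}.  Notions needed both for kappa and for the ordinals below it   *)
(* take an initial segment S : set K: kappa is [set: K] and a is below a.      *)

Section Ordinals.
Context {d : Order.disp_t} {K : orderType d}.
Implicit Types (a b : K) (S B C L : set K).

Definition below a : set K := [set x | x < a].

Definition seg a := {x : K | x < a}.

(* ^a 2 *)
Definition lev a := seg a -> bool.

Definition is_succ a b := a < b /\ forall x, a < x -> b <= x.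

Definition is_limit a :=
  (exists x, x < a) /\ forall x, x < a -> exists2 y, x < y & y < a.

Definition card_lt {T U : Type} (X : set T) (Y : set U) : Prop :=
  X #<= Y /\ ~ (Y #<= X).

Definition is_cardinal S := forall b, S b -> card_lt (below b) S.

Definition cofinal_in S B :=
  B `<=` S /\ forall x, S x -> exists2 y, B y & x <= y.

(* cf(S) = |L| *)
Definition cof_eq S L :=
  (exists2 B, cofinal_in S B & B #= L) /\
  (forall B, cofinal_in S B -> L #<= B).

Definition infinite_cardinal S := is_cardinal S /\ infinite_set S.

Definition regular_cardinal S := infinite_cardinal S /\ cof_eq S S.

Definition singular_cardinal S := infinite_cardinal S /\ ~ cof_eq S S.

Definition strong_limit S :=
  forall b, S b -> is_cardinal (below b) -> card_lt [set: lev b] S.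

Definition inaccessible S :=
  [/\ regular_cardinal S, ~ countable S & strong_limit S].

(* m = l^+ *)
Definition is_succ_cardinal (l m : K) :=
  [/\ is_cardinal (below m), l < m &
      forall b, is_cardinal (below b) -> l < b -> m <= b].

Definition club C :=
  cofinal_in [set: K] C /\
  forall a, is_limit a -> cofinal_in (below a) (C `&` below a) -> C a.

Definition stationary B := forall C, club C -> exists x, B x /\ C x.

End Ordinals.

Definition first_inaccessible {d : Order.disp_t} (K : orderType d) :=
  inaccessible [set: K] /\ forall a : K, ~ inaccessible (below a).

Definition Mahlo {d : Order.disp_t} (K : orderType d) :=
  inaccessible [set: K] /\
  stationary [set a : K | regular_cardinal (below a)].

Section Trees.
Context {d : Order.disp_t} {K : orderType d}.
Implicit Types a b : K.

Definition restr a b (h : a <= b) (f : lev b) : lev a :=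
  fun x => f (exist _ (sval x) (lt_le_trans (svalP x) h)).

Definition init_seg a b (f : lev a) (g : lev b) :=
  exists h : a <= b, restr h g = f.

Definition proper_init_seg a b (f : lev a) (g : lev b) :=
  a < b /\ init_seg f g.

(* The concatenation f^i when b is the successor of a; only used for such b. *)
Definition snoc a b (f : lev a) (i : bool) : lev b :=
  fun x => if insub (sval x) : option {y : K | y < a} is Some y then f y else i.

(* A set of nodes T is given by its levels T a, a subset of ^a 2. *)
Definition subtree (T : forall a, set (lev a)) :=
  (exists a, exists f : lev a, T a f) /\
  (forall a b (h : a <= b) (f : lev b), T b f -> T a (restr h f)).

Definition regular_subtree (T : forall a, set (lev a)) :=
  [/\ subtree T,
      forall a (f : lev a) b, T a f ->
        exists2 g : lev (Order.max a b), T _ g & init_seg f g &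
      forall b (f : lev b), is_limit b ->
        (forall a (h : a < b), T a (restr (ltW h) f)) -> T b f].

Definition suitable (T : forall a, set (lev a)) (A : set K) :=
  [/\ A #= [set: K], regular_subtree T &
      forall a (f : lev a), T a f ->
        ((exists2 b, is_succ a b & forall i : bool, T b (snoc f i)) <-> A a)].

End Trees.

(* [X]^n *)
Definition nsubset (n : nat) (X : Type) := {s : set X | s #= `I_n}.

(* R is the reflexive form of a well-ordering, as in wochoice. *)
Definition strict {X : Type} (R : rel X) (x y : X) := R x y /\ x <> y.

(* HL^+_{n,theta}[kappa], where Theta is a type of cardinality theta. *)
Definition HLplus {d : Order.disp_t} (K : orderType d) (n : nat)
    (Theta : Type) :=
  forall (R : forall a : K, rel (lev a)), (forall a, well_order (R a)) ->
  forall c : forall a : K, nsubset n (lev a) -> Theta,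
  exists (T : forall a : K, set (lev a)) (A : set K),
    suitable T A /\
    forall (a : K) (eta : 'I_n -> lev a),
      (forall l, T a (eta l)) -> injective eta ->
      exists t : Theta,
        forall (b : K) (nu : 'I_n -> lev b),
          A b ->
          (forall l, T b (nu l) /\ proper_init_seg (eta l) (nu l)) ->
          (forall l m : 'I_n, (l < m)%N -> strict (R b) (nu l) (nu m)) ->
          forall s : nsubset n (lev b), sval s = range nu -> c b s <> t.

(* Main.v *)
Require Import Defs.
From mathcomp Require Import all_boot all_order.
From mathcomp Require Import boolp classical_sets functions cardinality wochoice.

Set Implicit Arguments.
Unset Strict Implicit.
Unset Printing Implicit Defensive.

Import Order.TTheory.
Local Open Scope classical_set_scope.
Local Open Scope card_scope.
Local Open Scope order_scope.

(** A pair of nodes is coloured by looking at it at strong limit levels [z].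
    There are only [2^z] many closed requirements on pairs of nodes of length
    [z], so a Bernstein construction provides, for each of them and for each
    index [g < z], a star (a centre with [2^g] many leaves) satisfying it,
    coloured so as to realise two given colours, one for either order of the
    pair; hence the well-orderings play no role.  At level [b] several levels
    [z] compete for the colour of a pair; the one with the least [(r b z, z)]
    wins, where [r b] is regressive and takes values [<= g] at most [g] times.
    Given a suitable tree, take [z] with [|A `&` z| = z] and [b >= z] in [A],
    and split at a level of [A] followed by many further splittings before the
    next of the few levels [w < z] of higher priority: the latter can then be
    avoided by a requirement.  The levels [w > z] of higher priority have smaller
    stars and spoil fewer than [2^g] many leaves.  So some pair gets an omitted
    colour.

    For [r]: if [kappa] is inaccessible and not Mahlo, the levels may be chosen
    singular, and [r b] is built by induction on [b]; if [kappa] is singular,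
    [cf kappa] many levels suffice and [r] may be constant.  The first
    inaccessible is not Mahlo since a regular strong limit would be
    inaccessible. *)

(* The relation need not be functional: that makes [cle] easy to establish,
   and choice turns it into an injection (lemma [cleP]). *)
Definition cle {T U : Type} (A : set T) (B : set U) : Prop :=
  exists G : T -> U -> Prop,
    (forall x, A x -> exists2 y, B y & G x y) /\
    (forall x x' y, A x -> A x' -> G x y -> G x' y -> x = x').

(** * Comparison of cardinalities through [cle] *)

Section Cle.
Implicit Types T U V : Type.

Lemma cleP T U (A : set T) (B : set U) : (A #<= B) <-> cle A B.
Proof.
split=> [/card_leP[f]|[G [Gt Gi]]].
  exists (fun x y => exists2 a : A, val a = x & val (f a) = y); split.
    move=> x Ax; have xA : x \in A by rewrite inE.
    exists (val (f (SigSub xA))); first exact: set_valP.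
    by exists (SigSub xA).
  move=> x x' y _ _ [a <- <-] [a' <- /val_inj E].
  by congr val; apply: (@injT _ _ f).
have Ge (a : A) : exists b : B, G (val a) (val b).
  have [y By Gay] := Gt _ (set_valP a).
  have yB : y \in B by rewrite inE.
  by exists (SigSub yB).
have [f fG] := choice Ge.
apply/card_leP/injfunPex; exists f => // a a' _ _ E.
apply: val_inj; apply: (Gi _ _ (val (f a))); [exact: set_valP|exact: set_valP| |].
  exact: fG.
by rewrite E; exact: fG.
Qed.

Lemma cle_trans U T V (B : set U) (A : set T) (C : set V) :
  cle A B -> cle B C -> cle A C.
Proof.
move=> [G [Gt Gi]] [H [Ht Hi]].
exists (fun x z => exists y, [/\ B y, G x y & H y z]); split.
  move=> x /Gt[y By Gxy]; have [z Cz Hyz] := Ht _ By.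
  by exists z => //; exists y.
move=> x x' z Ax Ax' [y [By Gxy Hyz]] [y' [By' Gxy' Hyz']].
by move: Gxy'; rewrite -(Hi _ _ _ By By' Hyz Hyz') => /(Gi _ _ _ Ax Ax' Gxy).
Qed.

Lemma cle_sub T (A B : set T) : A `<=` B -> cle A B.
Proof.
move=> AB; exists eq; split=> [x Ax|x x' y _ _ -> ->//].
by exists x => //; apply: AB.
Qed.

Lemma cle_refl T (A : set T) : cle A A.
Proof. exact: cle_sub. Qed.

Lemma cle_subl T U (A A' : set T) (B : set U) :
  A `<=` A' -> cle A' B -> cle A B.
Proof. by move=> /cle_sub; apply: cle_trans. Qed.

Lemma cle_subr T U (A : set T) (B B' : set U) :
  B `<=` B' -> cle A B -> cle A B'.
Proof. by move=> /cle_sub s /cle_trans; apply. Qed.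

Lemma cle_img T U (A : set T) (B : set U) (f : T -> U) :
  (forall x, A x -> B (f x)) ->
  (forall x x', A x -> A x' -> f x = f x' -> x = x') -> cle A B.
Proof.
move=> fAB fi; exists (fun x y => f x = y); split=> [x Ax|x x' y Ax Ax' <- /esym].
  by exists (f x) => //; apply: fAB.
exact: fi.
Qed.

Lemma cle_fun T U (B : set U) : cle [set: T] B ->
  exists2 f : T -> U, (forall x, B (f x)) & injective f.
Proof.
move=> [G [Gt Gi]].
have /choice[f fG] : forall x : T, exists y, B y /\ G x y.
  by move=> x; have [y] := Gt x I; exists y.
exists f => [x|x x' E]; first exact: (fG x).1.
by apply: (Gi _ _ (f x)) => //; [exact: (fG x).2|rewrite E; exact: (fG x').2].
Qed.

Lemma cle_image T U (A : set T) (B : set U) : cle A B ->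
  exists B' : set U, [/\ B' `<=` B, cle A B' & cle B' A].
Proof.
move=> [G [Gt Gi]].
have /choice[f fG] : forall x : T, exists y : option U,
    A x -> exists2 u, y = Some u & B u /\ G x u.
  move=> x; have [/Gt[u Bu Gu]|nA] := pselect (A x); last by exists None.
  by exists (Some u) => _; exists u.
exists [set u | exists2 x, A x & f x = Some u]; split.
- by move=> u [x Ax E]; have [u' + []] := fG x Ax; rewrite E => -[->].
- exists (fun x u => f x = Some u); split.
    by move=> x Ax; have [u E _] := fG x Ax; exists u => //; exists x.
  move=> x x' u Ax Ax' E E'.
  have [v + [_ Gxv]] := fG x Ax; rewrite E => -[?]; subst v.
  have [v + [_ Gxv']] := fG x' Ax'; rewrite E' => -[?]; subst v.
  exact: (Gi _ _ u).
exists (fun u x => f x = Some u); split.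
  by move=> u [x Ax E]; exists x.
by move=> u u' x _ _ -> [].
Qed.

Lemma cle_prod T T' U U' (A : set T) (A' : set T') (B : set U) (B' : set U') :
  cle A B -> cle A' B' -> cle (A `*` A') (B `*` B').
Proof.
move=> [G [Gt Gi]] [H [Ht Hi]].
exists (fun p q => G p.1 q.1 /\ H p.2 q.2); split.
  by move=> [x x'] /= [/Gt[y By Gy] /Ht[y' By' Hy]]; exists (y, y').
move=> [x x'] [z z'] [y y'] /= [Ax Ax'] [Az Az'] [G1 H1] [G2 H2].
by rewrite (Gi _ _ _ Ax Az G1 G2) (Hi _ _ _ Ax' Az' H1 H2).
Qed.

Lemma cle_bigcup T U V W (D : set T) (F : T -> set U) (B : set V) (C : set W) :
  cle D B -> (forall t, D t -> cle (F t) C) ->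
  cle [set u | exists2 t, D t & F t u] (B `*` C).
Proof.
move=> [G [Gt Gi]] FC.
have /choice[H HP] : forall t, exists H : U -> W -> Prop, D t ->
    (forall x, F t x -> exists2 y, C y & H x y) /\
    (forall x x' y, F t x -> F t x' -> H x y -> H x' y -> x = x').
  move=> t; have [/FC[H HP]|nD] := pselect (D t); first by exists H.
  by exists (fun _ _ => False).
exists (fun u p => exists t, [/\ D t, F t u, G t p.1 & H t u p.2]); split.
  move=> u [t Dt Fu]; have [v Bv Gv] := Gt _ Dt.
  by have [w Cw Hw] := (HP t Dt).1 _ Fu; exists (v, w) => //; exists t.
move=> u u' [v w] /= _ _ [t [Dt Fu Gv Hw]] [t' [Dt' Fu' Gv' Hw']].
have E := Gi _ _ _ Dt Dt' Gv Gv'; subst t'.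
exact: (HP t Dt).2 Fu Fu' Hw Hw'.
Qed.

Lemma cle_pow T U : cle [set: T] [set: U] -> cle [set: T -> bool] [set: U -> bool].
Proof.
move=> /cle_fun[f _ fi].
apply: (@cle_img _ _ _ _ (fun (F : T -> bool) u => `[< exists2 t, f t = u & F t >])) => //.
move=> F F' _ _ E; apply/funext => t.
have /(congr1 (fun g => g (f t))) /= := E.
have H (F0 : T -> bool) : `[< exists2 t0, f t0 = f t & F0 t0 >] = F0 t.
  apply/asboolP/idP => [[t0 /fi-> //]|Ft]; by exists t.
by rewrite !H.
Qed.

Lemma Cantor T (A : set T) : ~ cle [set: T -> bool] A.
Proof.
move=> [G [Gt Gi]].
pose F t := `[< exists2 f : T -> bool, G f t & ~~ f t >].
have [t _ Gt'] := Gt F I.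
have : F t = ~~ F t.
  apply/asboolP/idP => [[f Gf]|nF]; last by exists F.
  by rewrite (Gi F f t I I Gt' Gf).
by case: (F t).
Qed.

(** Each [g] in [B] owns a point of [C], and [F] takes the opposite of [g] there. *)
Lemma diagonal_avoid T (B : set (T -> bool)) (C : set T) : cle B C ->
  exists F : T -> bool, forall g, B g -> exists2 a, C a & F a <> g a.
Proof.
move=> [G [Gt Gi]].
exists (fun a => `[< exists g, [/\ B g, G g a & ~~ g a] >]) => g Bg.
have [a Ca Ga] := Gt _ Bg; exists a => //.
case Ega: (g a); last by move=> /asboolPn; apply; exists g; rewrite Ega.
by move=> /asboolP[g' [Bg' Gg']]; rewrite -(Gi _ _ _ Bg Bg' Ga Gg') Ega.
Qed.

(** Recursion along [lt]: the earlier indices are too few to exhaust [S i], so a value not taken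
    before is left. *)
Lemma inj_choice_wf I X (lt : I -> I -> Prop) (D : set I) (S : I -> set X) :
  well_founded lt ->
  (forall i j, D i -> D j -> i = j \/ lt i j \/ lt j i) ->
  (forall i, D i -> ~ cle (S i) [set j | D j /\ lt j i]) ->
  exists s : I -> X -> Prop,
    (forall i, D i -> exists2 x, S i x & s i x) /\
    (forall i j x, D i -> D j -> s i x -> s j x -> i = j).
Proof.
move=> wf tot HS.
have [[i0 Di0]|D0] := pselect (exists i, D i); last first.
  by exists (fun _ _ => False); split=> [i Di|//]; case: D0; exists i.
have [x0 _] : exists x, S i0 x.
  apply: contrapT => nS; apply: (HS _ Di0).
  by exists (fun _ _ => False); split=> // x Sx; case: nS; exists x.
pose step i (rec : forall j, lt j i -> X) : X :=
  @xget {classic X} x0 [set x | S i x /\ forall j (h : lt j i), D j -> rec j h <> x].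
pose s := Fix wf (fun _ => X) step.
have sE i : s i = step i (fun j _ => s j).
  rewrite /s Fix_eq // => j f g fg; congr (step j _).
  by apply: functional_extensionality_dep => k; apply: functional_extensionality_dep.
have sP i : D i -> S i (s i) /\ forall j, lt j i -> D j -> s j <> s i.
  move=> Di; rewrite [s i]sE.
  pose P : set X := [set x | S i x /\ forall j, lt j i -> D j -> s j <> x].
  suff /(@xgetPex {classic X} x0 P)[] : exists x, P x by [].
  apply: contrapT => nex.
  apply: (HS _ Di); exists (fun x j => s j = x); split=> [x Sx|x x' j _ _ <- <-//].
  apply: contrapT => nj; apply: nex; exists x; split=> // j h Dj E.
  by apply: nj; exists j.
exists (fun i x => s i = x); split.
  by move=> i Di; exists (s i) => //; exact: (sP i Di).1.
move=> i j x Di Dj <- E; have [//|[h|h]] := tot _ _ Di Dj.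
  by case: ((sP _ Dj).2 _ h Di).
by case: ((sP _ Di).2 _ h Dj).
Qed.

(** * Well-orderings and choice of distinct representatives *)

Section WellOrder.
Variables (T : Type) (R : rel T).
Hypothesis Rwo : well_order R.

Lemma wo_min (P : T -> Prop) : (exists x, P x) ->
  exists2 x, P x & forall y, P y -> R x y.
Proof.
move=> [x Px].
have [|z [[/asboolP Pz zmin] _]] := Rwo (A := fun x => `[< P x >]).
  by exists x; exact/asboolP.
by exists z => // y Py; apply: zmin; exact/asboolP.
Qed.

Lemma wo_total x y : R x y \/ R y x.
Proof.
have [|z] := @wo_min (fun z => z = x \/ z = y); first by exists x; left.
by move=> [] -> H; [left; apply: H; right|right; apply: H; left].
Qed.

Lemma wo_anti x y : R x y -> R y x -> x = y.
Proof.
move=> Rxy Ryx; have Rr u : R u u by case: (wo_total u u).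
have [|z [_ zu]] := Rwo (A := fun z => `[< z = x \/ z = y >]).
  by exists x; apply/asboolP; left.
have <- : z = x.
  by apply: zu; split=> [|u /asboolP[->|->]//]; apply/asboolP; left.
by apply: zu; split=> [|u /asboolP[->|->]//]; apply/asboolP; right.
Qed.

Lemma wo_wf : well_founded (strict R).
Proof.
move=> x; apply: contrapT => nx.
have [z nz zmin] := @wo_min (fun x => ~ Acc (strict R) x) (ex_intro _ x nx).
apply: nz; constructor => y [Ryz nyz]; apply: contrapT => /zmin Rzy.
by apply: nyz; apply: wo_anti.
Qed.

Lemma wo_strict_total x y : x = y \/ strict R x y \/ strict R y x.
Proof.
have [->|nxy] := pselect (x = y); first by left.
by right; case: (wo_total x y) => H; [left|right]; split=> // /esym.
Qed.

End WellOrder.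

(** The order has the type of an initial ordinal. If a given well-ordering has an initial segment of
    full size, take the shortest one and pull the order back along an injection of [X] into it. *)
Lemma min_well_order X : exists lt : X -> X -> Prop,
  [/\ well_founded lt, (forall x y, x = y \/ lt x y \/ lt y x) &
      forall x, ~ cle [set: X] [set y | lt y x]].
Proof.
have [R Rwo] := well_ordering_principle {classic X}.
have [nex|] := pselect (forall x, ~ cle [set: X] [set y | strict R y x]).
  by exists (strict R); split; [exact: (wo_wf Rwo)|exact: (wo_strict_total Rwo)|exact: nex].
move=> /existsNP[x /contrapT cx].
have [x0 cx0 x0min] := @wo_min _ _ Rwo
  (fun x => cle [set: X] [set y | strict R y x]) (ex_intro _ x cx).
have [h hx0 hi] := cle_fun cx0.
exists (fun y x => strict R (h y) (h x)); split.
- move=> y; move: (wo_wf Rwo (h y)).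
  move E : (h y) => u A; elim: A y E => {}u _ IH y E.
  by constructor => v; rewrite E => /IH; apply.
- move=> y z; have [/hi ->|] := wo_strict_total Rwo (h y) (h z); first by left.
  by right.
- move=> y cy.
  have /x0min R0 : cle [set: X] [set u | strict R u (h y)].
    by apply: cle_trans cy _; apply: (@cle_img _ _ _ _ h) => // ? ? _ _ /hi.
  have [R1] := hx0 y; apply; exact: wo_anti R1 R0.
Qed.

(** Enumerated in the order of [min_well_order], every index has fewer than [|X|] predecessors,
    whereas [S i] has full size. *)
Lemma inj_choice I X (S : I -> set X) : cle [set: I] [set: X] ->
  (forall i, cle [set: X] (S i)) ->
  exists2 s : I -> X, injective s & forall i, S i (s i).
Proof.
move=> /cle_fun[e _ ei] HS.
have [lt [wf tot small]] := min_well_order X.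
have [||i _|s [st si]] := @inj_choice_wf I X (fun i j => lt (e i) (e j)) setT S.
- move=> y; move: (wf (e y)).
  move E : (e y) => u A; elim: A y E => {}u _ IH y E.
  by constructor => v; rewrite E => /IH; apply.
- by move=> i j _ _; case: (tot (e i) (e j)) => [/ei|]; [left|right].
- move=> c; apply: (small (e i)); apply: cle_trans (HS i) _.
  apply: cle_trans c _; apply: (@cle_img _ _ _ _ e); first by move=> ? [].
  by move=> ? ? _ _ /ei.
have /choice[f fP] : forall i, exists x, S i x /\ s i x.
  by move=> i; have [x] := st i Logic.I; exists x.
exists f => [i j E|i]; last exact: (fP i).1.
by apply: (si _ _ (f i)) => //; [exact: (fP i).2|rewrite E; exact: (fP j).2].
Qed.

End Cle.

(** * Cardinal arithmetic below a strong limit *)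

Section StrongLimit.
Context {d : Order.disp_t} {K : orderType d}.
Hypothesis wK : well_order (<=%O : rel K).
Implicit Types (a b c e g : K) (A B : set K).

Lemma Kmin (P : K -> Prop) : (exists x, P x) ->
  exists2 x, P x & forall y, P y -> x <= y.
Proof. exact: wo_min. Qed.

Lemma K_wf : well_founded (fun a b : K => a < b).
Proof.
move=> x; apply: contrapT => nx.
have [z nz zmin] := @Kmin (fun x => ~ Acc (fun a b : K => a < b) x) (ex_intro _ x nx).
apply: nz; constructor => y yz; apply: contrapT => /zmin.
by rewrite leNgt yz.
Qed.

Lemma succ_ex a b : a < b -> exists c, is_succ a c.
Proof. by move=> ab; have [c ac H] := @Kmin (fun c => a < c) (ex_intro _ b ab); exists c. Qed.

(** The case of a constant family in [inj_choice_wf]; it serves as comparability of cardinals. *)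
Lemma cle_initial T (D : set K) (B : set T) :
  (forall a, D a -> ~ cle B [set x | D x /\ x < a]) -> cle D B.
Proof.
move=> H.
have [] := @inj_choice_wf K T (fun a b : K => a < b) D (fun=> B) K_wf.
- by move=> i j _ _; case: (ltgtP i j) => [||->]; [right; left|right; right|left].
- by move=> i Di /= c; apply: (H i Di).
by move=> s [st si]; exists s.
Qed.

Lemma small_below T (S : set K) (A : set T) :
  ~ cle S A -> exists2 c, S c & cle A (below c).
Proof.
move=> nS; apply: contrapT => nex; apply: nS; apply: cle_initial => a Sa c.
apply: nex; exists a => //; apply: cle_subr c; by move=> x [].
Qed.

Lemma cle_below a b : a <= b -> cle (below a) (below b).
Proof. by move=> ab; apply: cle_sub => x /lt_le_trans; apply. Qed.

Lemma cle_below_seg a : cle (below a) [set: seg a].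
Proof. by exists (fun x s => x = sval s); split=> [x xa|x x' s _ _ -> ->//]; exists (exist _ x xa). Qed.

Lemma cle_seg_below a : cle [set: seg a] (below a).
Proof. by apply: (@cle_img _ _ _ _ sval) => [[]//|s s' _ _ /val_inj]. Qed.

Lemma cle_lev a b : a <= b -> cle [set: lev a] [set: lev b].
Proof.
move=> ab; apply: cle_pow; apply: cle_trans (cle_seg_below a) _.
exact: cle_trans (cle_below ab) (cle_below_seg b).
Qed.

Lemma cle_below_lev a : cle (below a) [set: lev a].
Proof.
apply: cle_trans (cle_below_seg a) _.
apply: (@cle_img _ _ _ _ (fun s : seg a => (fun x => x == s) : lev a)) => // s s' _ _.
by move=> /(congr1 (fun f : lev a => f s)) /=; rewrite eqxx => /esym /eqP.
Qed.

Lemma Cantor_lev a : ~ cle [set: lev a] (below a).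
Proof. by move=> /cle_trans /(_ (cle_below_seg a)); exact: Cantor. Qed.

(* Strong limit cardinals: that [g] is an infinite cardinal is a consequence. *)
Definition SL g := (exists x, x < g) /\
  forall c, c < g -> exists2 e, e < g & cle [set: lev c] (below e).

Lemma lev_lt a b : cle [set: lev a] (below b) -> a < b.
Proof.
by move=> c; rewrite ltNge; apply/negP => /cle_below /(cle_trans c); exact: Cantor_lev.
Qed.

Lemma SL_limit g c : SL g -> c < g -> exists2 e, c < e & e < g.
Proof. by move=> [_ H] /H[e eg /lev_lt]; exists e. Qed.

Lemma SL_is_limit g : SL g -> is_limit g.
Proof. by move=> h; split; [exact: h.1|move=> x; exact: SL_limit]. Qed.

Lemma SL_card g c : SL g -> c < g -> ~ cle (below g) (below c).
Proof.
move=> [_ H] /H[e eg Hc] Hg; apply: (@Cantor_lev c); apply: cle_trans Hc _.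
exact: cle_trans (cle_below (ltW eg)) Hg.
Qed.

Lemma SL_lev g c : SL g -> c < g -> cle [set: lev c] (below g).
Proof. by move=> [_ H] /H[e /ltW/cle_below eg] /cle_trans; apply. Qed.

(** Kuratowski pairs: [pr x y] is the set [{x, y}] as an element of [lev c], [j] codes such sets
    below [e], and [kp] is the set of the codes of [{x}] and [{x, y}]. Two power sets thus suffice,
    and both stay below [g]. *)
Lemma SL_pair_lt g c : SL g -> c < g ->
  exists2 e, e < g & cle (below c `*` below c) (below e).
Proof.
move=> hg cg; have [e eg He] := hg.2 _ cg; have [e' e'g He'] := hg.2 _ eg.
exists e' => //; apply: cle_trans He'.
have [j je ji] := cle_fun He.
pose pr x y : lev c := fun s => (sval s == x) || (sval s == y).
pose kp (p : K * K) : lev e :=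
  fun s => (sval s == j (pr p.1 p.1)) || (sval s == j (pr p.1 p.2)).
have kpP p f : kp p (exist _ (j f) (je f)) -> f = pr p.1 p.1 \/ f = pr p.1 p.2.
  by move=> /orP[] /eqP /ji; [left|right].
have prP x y (xc : x < c) x' y' : pr x y = pr x' y' -> x = x' \/ x = y'.
  move=> /(congr1 (fun f : lev c => f (exist _ x xc))).
  by rewrite /pr /= eqxx /= => /esym /orP[] /eqP; [left|right].
have prC x y : pr x y = pr y x by apply/funext => s; rewrite /pr orbC.
apply: (@cle_img _ _ _ _ kp) => // -[x y] [x' y'] /= [xc yc] [xc' yc'] E.
have E1 f : f = pr x x \/ f = pr x y -> f = pr x' x' \/ f = pr x' y'.
  move=> H; apply: (kpP (x', y')); rewrite -E; apply/orP.
  by case: H => ->; [left|right]; rewrite /= eqxx.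
have E2 f : f = pr x' x' \/ f = pr x' y' -> f = pr x x \/ f = pr x y.
  move=> H; apply: (kpP (x, y)); rewrite E; apply/orP.
  by case: H => ->; [left|right]; rewrite /= eqxx.
have Ex : x = x'.
  have [H|H] := E1 _ (or_introl erefl); first by case: (prP _ _ xc _ _ H).
  by case: (prP _ _ xc' _ _ (esym H)).
subst x'.
have H1 : y = x \/ y = y'.
  have := E1 _ (or_intror erefl); rewrite [pr x y]prC.
  by case=> /(prP _ _ yc)[]; auto.
have H2 : y' = x \/ y' = y.
  have := E2 _ (or_intror erefl); rewrite [pr x y']prC.
  by case=> /(prP _ _ yc')[]; auto.
by case: H1 H2 => E3 [] E4; congr pair; congruence.
Qed.

(** Pairs are ordered by their maximum first, ties being broken by an arbitrary well-ordering. The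
    predecessors of a pair lie in a square over some [c < g], which is small by [SL_pair_lt]. *)
Lemma SL_mul g : SL g -> cle (below g `*` below g) (below g).
Proof.
move=> hg.
have [R Rwo] := well_ordering_principle (K * K)%type.
pose mx (p : K * K) := Order.max p.1 p.2.
pose lt p q := mx p < mx q \/ mx p = mx q /\ strict R p q.
have wf : well_founded lt.
  suff H m : forall p, mx p = m -> Acc lt p by move=> p; exact: (H (mx p)).
  elim: (K_wf m) => {}m _ IHm p; elim: (wo_wf Rwo p) => {}p _ IHp Em.
  constructor => q [|[Eq qp]]; first by rewrite Em => /IHm; apply.
  by apply: IHp => //; rewrite Eq.
have [] := @inj_choice_wf (K * K) K lt (below g `*` below g) (fun=> below g) wf.
- move=> p q _ _; rewrite /lt; case: (ltgtP (mx p) (mx q)) => [||E]; auto.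
  by have [|[]] := wo_strict_total Rwo p q; auto 6.
- move=> [x y] [/= xg yg] H.
  have mg : mx (x, y) < g by rewrite /mx /=; case: (leP x y).
  have [c mc cg] := SL_limit hg mg; have [e eg He] := SL_pair_lt hg cg.
  apply: (SL_card hg eg); apply: cle_trans H _; apply: cle_subl He.
  move=> [u v] [_ luv].
  have : mx (u, v) <= mx (x, y) by case: luv => [/ltW //|[-> _]].
  move=> /le_lt_trans /(_ mc); rewrite /mx /= => h.
  by split=> /=; apply: le_lt_trans h; rewrite le_max lexx ?orbT.
by move=> s [st si]; exists s.
Qed.

Lemma SL_bool g : SL g -> exists2 e, e < g & cle [set: bool] (below e).
Proof.
move=> hg; have [x xg] := hg.1; have [y xy yg] := SL_limit hg xg.
have [e ye eg] := SL_limit hg yg; exists e => //.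
apply: (@cle_img _ _ _ _ (fun b : bool => if b then x else y)).
  by case=> _ //=; exact: lt_trans ye.
by case; case=> //= _ _ E; move: xy; rewrite E ltxx.
Qed.

Lemma SL_bigcup g T U (D : set T) (F : T -> set U) : SL g ->
  cle D (below g) -> (forall t, D t -> cle (F t) (below g)) ->
  cle [set u | exists2 t, D t & F t u] (below g).
Proof. by move=> hg cD cF; apply: cle_trans (cle_bigcup cD cF) (SL_mul hg). Qed.

Lemma SL_bigcup_lt g c T U (D : set T) (F : T -> set U) : SL g -> c < g ->
  cle D (below c) -> (forall t, D t -> cle (F t) (below c)) ->
  exists2 e, e < g & cle [set u | exists2 t, D t & F t u] (below e).
Proof.
move=> hg cg cD cF; have [e eg He] := SL_pair_lt hg cg.
by exists e => //; apply: cle_trans (cle_bigcup cD cF) He.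
Qed.

Lemma bigcup_bool T (A B : set T) (x : T) : (A `|` B) x ->
  exists2 t, [set: bool] t & (if t then A else B) x.
Proof. by case; [exists true|exists false]. Qed.

Lemma SL_setU g T (A B : set T) : SL g ->
  cle A (below g) -> cle B (below g) -> cle (A `|` B) (below g).
Proof.
move=> hg cA cB; apply: cle_subl (@bigcup_bool _ A B) _.
have [e eg He] := SL_bool hg.
by apply: SL_bigcup => //; [exact: cle_trans He (cle_below (ltW eg))|case].
Qed.

Lemma SL_setU_lt g c c' T (A B : set T) : SL g -> c < g -> c' < g ->
  cle A (below c) -> cle B (below c') ->
  exists2 e, e < g & cle (A `|` B) (below e).
Proof.
move=> hg cg cg' cA cB; have [e eg He] := SL_bool hg.
have mg : Order.max (Order.max c c') e < g by rewrite !gt_max cg cg' eg.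
have [|t _|e' e'g He'] := SL_bigcup_lt (D := [set: bool])
    (F := fun t => if t then A else B) hg mg.
- by apply: cle_trans He _; apply: cle_below; rewrite le_max lexx orbT.
- by case: t; [apply: cle_trans cA _|apply: cle_trans cB _]; apply: cle_below;
    rewrite !le_max lexx ?orbT.
by exists e' => //; exact: cle_subl (@bigcup_bool _ A B) He'.
Qed.

Lemma cle_setU1 T (A : set T) x c c' : cle A (below c) -> c < c' ->
  cle (x |` A) (below c').
Proof.
move=> [G [Gt Gi]] cc'.
exists (fun u y => (u = x /\ y = c) \/ [/\ A u, y < c & G u y]); split.
  move=> u [->|Au]; first by exists c => //; left.
  have [y yc Gy] := Gt _ Au; exists y; first exact: lt_trans cc'.
  by right.
move=> u u' y _ _ [[-> ->]|[Au yc Gu]] [[-> ?]|[Au' yc' Gu']] //.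
- by move: yc'; rewrite ltxx.
- by subst y; move: yc; rewrite ltxx.
- exact: (Gi _ _ y).
Qed.

Lemma SL_lev_mul g : SL g -> cle [set: lev g * lev g] [set: lev g].
Proof.
move=> hg; apply: cle_trans (_ : cle _ [set: seg g * bool -> bool]) _.
  apply: (@cle_img _ _ _ _ (fun (p : lev g * lev g) (q : seg g * bool) =>
    if q.2 then p.1 q.1 else p.2 q.1)) => // -[u v] [u' v'] _ _ /= E.
  congr pair; apply/funext => s.
    exact: (congr1 (fun f : seg g * bool -> bool => f (s, true)) E).
  exact: (congr1 (fun f : seg g * bool -> bool => f (s, false)) E).
apply: cle_pow; apply: cle_trans (_ : cle _ (below g `*` below g)) _; last first.
  exact: cle_trans (SL_mul hg) (cle_below_seg g).
have [e eg /cle_trans/(_ (cle_below (ltW eg))) He] := SL_bool hg.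
rewrite -setXTT; exact: cle_prod (cle_seg_below g) He.
Qed.

End StrongLimit.

(** * Branches through a suitable tree, and the lexicographic order *)

Section Branches.
Context {d : Order.disp_t} {K : orderType d}.
Hypothesis wK : well_order (<=%O : rel K).
Implicit Types (a b c : K) (F G : K -> bool).

Definition res a F : lev a := fun s => F (sval s).
Arguments res : clear implicits.

(* Junk value [false] outside the domain. *)
Definition ext a (f : lev a) : K -> bool :=
  fun x => if insub x : option {y : K | y < a} is Some y then f y else false.

Lemma ext_out a (f : lev a) x : ext f x -> x < a.
Proof. by rewrite /ext; case: insubP. Qed.

Lemma res_ext a (f : lev a) : res a (ext f) = f.
Proof.
apply/funext => s; rewrite /res /ext insubT ?(svalP s) // => h.
by congr f; apply: val_inj.
Qed.

Lemma ext_res a F x : x < a -> ext (res a F) x = F x.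
Proof. by move=> xa; rewrite /ext insubT. Qed.

Lemma res_eqP a F G : res a F = res a G <-> forall x, x < a -> F x = G x.
Proof.
split=> [E x xa|E]; last by apply/funext => s; exact: E (svalP s).
exact: (congr1 (fun f : lev a => f (exist _ x xa)) E).
Qed.

Lemma restr_res a b (h : a <= b) F : restr h (res b F) = res a F.
Proof. by []. Qed.

Lemma restrE a b (h : a <= b) (f : lev b) : restr h f = res a (ext f).
Proof. by rewrite -{1}[f]res_ext restr_res. Qed.

Lemma res_res a b F : a <= b -> res a (ext (res b F)) = res a F.
Proof. by move=> ab; apply/res_eqP => x xa; rewrite ext_res // (lt_le_trans xa). Qed.

Lemma snoc_res a b F i : is_succ a b -> F a = i -> snoc (res a F) i = res b F :> lev b.
Proof.
move=> [ab abm] <-; apply/funext => s; rewrite /snoc /res.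
case: insubP => [u _ -> //|]; rewrite -leNgt => h; congr F.
apply/eqP; rewrite eq_le h /= leNgt; apply/negP => /abm.
by rewrite leNgt (svalP s).
Qed.

(** The branch is built by recursion on levels. At a level of [A] both successors are in [T], so the
    value of [F] can be followed; at other levels a successor lying in [T] is taken; limit levels
    are covered by the closure of [T]. *)
Lemma branch (T : forall a, set (lev a)) (A : set K) (nomax : forall a, exists b, a < b)
    a (f : lev a) F : suitable T A -> T a f ->
  exists G, [/\ res a G = f, forall b, T b (res b G) &
                forall b, A b -> a <= b -> G b = F b].
Proof.
move=> [_ [[_ Tsub] Text Tlim] TA] Tf.
have /choice[S SP] : forall b, exists c, is_succ b c.
  by move=> b; have [c bc] := nomax b; exact: (succ_ex wK bc).
pose step b (u : lev b) : bool :=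
  if b < a then ext f b else if `[< A b >] then F b else `[< T (S b) (snoc u true) >].
pose G := Fix (K_wf wK) (fun _ => bool)
  (fun b rec => step b (fun s : seg b => rec (sval s) (svalP s))).
have GE b : G b = step b (res b G).
  rewrite /G Fix_eq // => x g h gh; congr (step x _).
  by apply/funext => s; exact: gh.
have Gf : res a G = f.
  rewrite -[RHS]res_ext; apply/res_eqP => x xa.
  by rewrite GE /step xa.
have GA b : A b -> a <= b -> G b = F b.
  move=> Ab ab; rewrite GE /step ltNge ab /=.
  by case: asboolP.
exists G; split=> // b; elim: (K_wf wK b) => {}b _ IH.
case: (leP b a) => [ba|ab].
  by rewrite -(res_res _ ba) -(restrE ba) Gf; exact: Tsub.
have [blim|nlim] := pselect (is_limit b).
  by apply: Tlim => // c cb; rewrite restr_res; exact: IH.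
have [c [cb cmax]] : exists c, is_succ c b.
  have [[x xb]|] := pselect (exists2 c, c < b & forall y, c < y -> b <= y).
    by move=> xmax; exists x.
  move=> nex; case: nlim; split; first by exists a.
  move=> x xb; apply: contrapT => ny; apply: nex; exists x => // y xy.
  by rewrite leNgt; apply/negP => yb; apply: ny; exists y.
have scb : is_succ c b by [].
have ac : a <= c by rewrite leNgt; apply/negP => /cmax; rewrite leNgt ab.
have ES : S c = b.
  have [cS Sm] := SP c; apply/eqP; rewrite eq_le Sm // cmax //.
have Tc := IH _ cb.
have [Ac|nAc] := pselect (A c).
  have [b' scb' Tb'] := (TA _ _ Tc).2 Ac.
  have E : b' = b by apply/eqP; rewrite eq_le (scb'.2 _ cb) (scb.2 _ scb'.1).
  by subst b'; rewrite -(snoc_res scb erefl); exact: Tb'.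
have Gc : G c = `[< T (S c) (snoc (res c G) true) >].
  by rewrite GE /step ltNge ac /=; case: asboolP.
(* Outside [A], regularity still extends the node to level [b]. So one of its two successors is in
   [T]: if [true] fails, [false] works. *)
have [g Tg [hg Eg]] := Text _ _ b Tc.
have hb : b <= Order.max c b by rewrite le_max lexx orbT.
have Tb := Tsub _ _ hb _ Tg.
rewrite restrE in Tb; rewrite restrE in Eg.
have EG x : x < c -> ext g x = G x by move: x; apply/res_eqP.
have Esn : snoc (res c G) (ext g c) = res b (ext g) :> lev b.
  by rewrite -(snoc_res scb erefl); congr (@snoc _ _ c b _ _); rewrite Eg.
rewrite -(snoc_res scb erefl) Gc ES.
case: asboolP => // nT.
by move: Tb; rewrite -Esn; case: (ext g c).
Qed.

Lemma node_extend (T : forall a, set (lev a)) (A : set K) (nomax : forall a, exists b, a < b)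
    a (f : lev a) : suitable T A -> T a f ->
  exists2 G, res a G = f & forall b, T b (res b G).
Proof. by move=> sT /(branch nomax (fun=> true) sT)[G [? ? _]]; exists G. Qed.

(** This order orients pairs uniformly on all levels, independently of the given well-orderings. *)
Definition lex F G := exists s, [/\ forall t, t < s -> F t = G t, F s = false & G s = true].

Lemma lex_asym F G : lex F G -> lex G F -> False.
Proof.
move=> [s [s1 s2 s3]] [s' [t1 t2 t3]]; case: (ltgtP s s') => [h|h|E].
- by move: (t1 _ h); rewrite s2 s3.
- by move: (s1 _ h); rewrite t2 t3.
- by move: t2; rewrite -E s3.
Qed.

Lemma lex_res a F G : lex (ext (res a F)) (ext (res a G)) -> lex F G.
Proof.
move=> [s [s1 s2 s3]]; have sa := ext_out s3.
exists s; split=> [t ts||]; [|by rewrite -s2 ext_res|by rewrite -s3 ext_res].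
by have := s1 t ts; rewrite !ext_res // (lt_trans ts).
Qed.

End Branches.

Arguments res {d K} a F _ : rename.

(** * Counting splitting levels and the branches they allow *)

Section Gaps.
Context {d : Order.disp_t} {K : orderType d}.
Hypothesis wK : well_order (<=%O : rel K).
Implicit Types (a b c e g z : K) (A W : set K).

(** [W] cuts [z] into few intervals. If each of them contained only about [c] members of [A], then
    [A] would have fewer than [|z|] members below [z]. *)
Lemma large_gap z g c A W : SL z -> g < z -> c < z -> cle W (below g) ->
  cle (below z) (A `&` below z) ->
  exists D, [/\ A D, D < z & cle (below c)
    [set a | [/\ A a, D < a, a < z & forall w, W w -> D < w -> a < w]]].
Proof.
move=> hz gz cz cW cA; apply: contrapT => nex.
pose G D := [set a | [/\ A a, D < a, a < z & forall w, W w -> D < w -> a < w]].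
have cG D : A D -> D < z -> cle (G D) (below c).
  move=> AD Dz; apply: cle_initial => // a _ H; apply: nex; exists D; split=> //.
  by apply: cle_subr H => x [].
have [c2 cc2 c2z] := SL_limit hz cz; have [g2 gg2 g2z] := SL_limit hz gz.
(* For [w] in [W] or equal to [z], [F w] covers the interval of [A] ending at [w]. Its members after
   the least one, [D], all belong to [G D]. *)
pose F w := [set a | [/\ A a, a < z, a < w & forall w', W w' -> a < w' -> w <= w']].
have cF w : cle (F w) (below c2).
  have [[a0 Fa0]|nF] := pselect (exists a, F w a); last first.
    by exists (fun _ _ => False); split=> // a Fa; case: nF; exists a.
  have [D FD Dmin] := Kmin wK (ex_intro (F w) a0 Fa0).
  have [AD Dz Dw Dn] := FD.
  apply: cle_subl (cle_setU1 D (cG D AD Dz) cc2) => a Fa.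
  have := Dmin _ Fa; rewrite le_eqVlt => /orP[/eqP ->|Da]; first by left.
  right; have [Aa az aw _] := Fa; split=> // w' Ww' /(Dn _ Ww').
  exact: lt_le_trans.
have mz : Order.max c2 g2 < z by rewrite gt_max c2z g2z.
have [|w _|e ez He] := SL_bigcup_lt (D := z |` W) (F := F) hz mz.
- apply: cle_trans (cle_setU1 z cW gg2) _.
  by apply: cle_below; rewrite le_max lexx orbT.
- apply: cle_trans (cF w) _.
  by apply: cle_below; rewrite le_max lexx.
apply: (SL_card hz ez); apply: cle_trans cA _; apply: cle_subl He => a [Aa az].
have [w [Ww aw] wmin] := Kmin wK
  (ex_intro (fun w => (z |` W) w /\ a < w) z (conj (or_introl erefl) az)).
exists w => //; split=> // w' Ww' aw'; apply: wmin; split=> //; by right.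
Qed.

Lemma large_remainder z c D A G : SL z -> c < z -> D < z -> cle G (below c) ->
  cle (below z) (A `&` below z) ->
  cle (below z) [set a | [/\ A a, D < a, a < z & ~ G a]].
Proof.
move=> hz cz Dz cG cA; apply: contrapT => /(small_below wK)[c' c'z Hc].
have [D' DD' D'z] := SL_limit hz Dz.
have [e ez He] := SL_setU_lt hz cz D'z cG (cle_refl _).
have [e' e'z He'] := SL_setU_lt hz ez c'z He Hc.
apply: (SL_card hz e'z); apply: cle_trans cA _; apply: cle_subl He' => a [Aa az].
have [Ga|nGa] := pselect (G a); first by left; left.
case: (leP a D) => aD; first by left; right; exact: le_lt_trans DD'.
by right.
Qed.

(** A subset of [z] is copied into [M] along an injection, prescribed there to a member of [Y], and
    read off again from its values on [M]. *)
Lemma cle_lev_prescribed z M (Y : set (lev z)) : cle (below z) M ->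
  M `<=` below z ->
  (forall F : K -> bool, exists2 G, Y (res z G) & forall a, M a -> G a = F a) ->
  cle [set: lev z] Y.
Proof.
move=> [J [Jt Ji]] Mz HY.
pose code (F : lev z) a := `[< exists2 s : seg z, J (sval s) a & F s >].
exists (fun F y => forall a, M a -> ext y a = code F a); split.
  move=> F _; have [G YG GM] := HY (code F); exists (res z G) => // a Ma.
  by rewrite ext_res ?GM //; exact: Mz.
move=> F F' y _ _ H H'; apply/funext => s.
have [a Ma Ja] := Jt _ (svalP s).
have cE (F0 : lev z) : code F0 a = F0 s.
  apply/asboolP/idP => [[s' Js' F0s']|F0s]; last by exists s.
  have /val_inj <- // := Ji _ _ a (svalP s') (svalP s) Js' Ja.
by rewrite -!cE -H // -H'.
Qed.

End Gaps.

(** * Stars with distinct centres for all rich requirements *)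

Section Bernstein.
Context {d : Order.disp_t} {K : orderType d}.
Hypothesis wK : well_order (<=%O : rel K).
Variable theta : K.
Implicit Types (a b c e g z : K).

Definition Node z := {s : seg z & (lev (sval s) * lev (sval s))%type}.

(* A closed relation on [lev z], coded by its approximations, and a colour
   for each of the two orientations of a pair. *)
Definition Req z := ((Node z -> bool) * (seg theta * seg theta))%type.

Definition Good z (q : Req z) (x y : lev z) :=
  forall s : seg z, q.1 (existT _ s (res (sval s) (ext x), res (sval s) (ext y))).

Definition rich z (q : Req z) :=
  cle [set: lev z] [set x | cle [set: lev z] [set y | Good q x y]].

Lemma cle_Node z : SL z -> cle [set: Node z] (below z).
Proof.
move=> hz.
apply: cle_subl (_ : _ `<=` [set n : Node z | exists2 s, [set: seg z] s &
  exists p, n = existT _ s p]) _; first by move=> [s p] _; exists s => //; exists p.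
apply: SL_bigcup => //; first exact: cle_seg_below.
move=> s _; have cs := SL_lev hz (svalP s).
apply: cle_trans (_ : cle _ [set: lev (sval s) * lev (sval s)]) _.
  exists (fun n p => n = existT _ s p); split; last by move=> ? ? ? _ _ -> ->.
  by move=> n [p ->]; exists p.
rewrite -setXTT; exact: cle_trans (cle_prod cs cs) (SL_mul wK hz).
Qed.

Lemma cle_Req z : SL z -> theta < z -> cle [set: Req z] [set: lev z].
Proof.
move=> hz tz; apply: cle_trans (SL_lev_mul wK hz).
rewrite -!setXTT; apply: cle_prod.
  exact: cle_pow (cle_trans (cle_Node hz) (cle_below_seg z)).
apply: cle_trans (cle_below_lev z); apply: cle_trans (SL_mul wK hz).
have ct : cle [set: seg theta] (below z).
  exact: cle_trans (cle_seg_below _) (cle_below (ltW tz)).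
exact: cle_prod.
Qed.

Definition bernstein_spec z g (p : (Req z -> lev z) * (Req z -> lev g -> lev z)) :=
  [/\ injective p.1, forall q, injective (p.2 q) &
      forall q, rich q -> forall f, Good q (p.1 q) (p.2 q f)].

Lemma bernstein z g : exists p : (Req z -> lev z) * (Req z -> lev g -> lev z),
  SL z -> theta < z -> g < z -> bernstein_spec p.
Proof.
have [[hz tz gz]|n] := pselect ([/\ SL z, theta < z & g < z]); last first.
  by exists (fun _ _ => true, fun _ _ _ => true) => *; case: n.
(* A requirement that is not rich allows every [x], so that each [S q] has full size and the centres
   are injective on all of [Req z]. *)
pose S (q : Req z) : set (lev z) :=
  [set x | rich q -> cle [set: lev z] [set y | Good q x y]].
have [q|xx xi xS] := inj_choice (S := S) (cle_Req hz tz).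
  have [rq|nrq] := pselect (rich q).
    by apply: cle_subr rq => x /= H _.
  by apply: cle_subr (cle_refl _) => x _ /nrq.
have /choice[yy yP] : forall q : Req z, exists h : lev g -> lev z,
    injective h /\ (rich q -> forall f, Good q (xx q) (h f)).
  move=> q; have cg := cle_lev (ltW gz).
  have [rq|nrq] := pselect (rich q).
    by have [h hG hi] := cle_fun (cle_trans cg (xS q rq)); exists h.
  by have [h _ hi] := cle_fun cg; exists h.
exists (xx, yy) => _ _ _; split=> // q; first exact: (yP q).1.
exact: (yP q).2.
Qed.

Definition center z g : Req z -> lev z := (projT1 (cid (bernstein z g))).1.
Definition leaf z g : Req z -> lev g -> lev z := (projT1 (cid (bernstein z g))).2.

Lemma centerP z g : SL z -> theta < z -> g < z -> bernstein_spec (@center z g, @leaf z g).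
Proof. by rewrite /center /leaf; case: (cid _) => -[]. Qed.

Definition edge z g (u v : lev z) :=
  lex (ext u) (ext v) /\ exists q, exists f, u = @center z g q /\ v = @leaf z g q f.

(** The centre is the lexicographically smaller end, so a pair belongs to one star even if both ends
    are centres. The first colour is for pairs listed centre first, the second for pairs listed leaf
    first. *)
Definition col z g (u v : lev z) (t : seg theta) := exists q f,
  [/\ lex (ext u) (ext v), u = @center z g q, v = @leaf z g q f & t = q.2.1] \/
  [/\ lex (ext v) (ext u), v = @center z g q, u = @leaf z g q f & t = q.2.2].

Lemma col_edge z g (u v : lev z) t : col g u v t -> edge g u v \/ edge g v u.
Proof.
by move=> [q [f [[l eu ev _]|[l ev eu _]]]]; [left|right]; split=> //; exists q, f.
Qed.

Lemma col_inj z g (u v : lev z) t t' : SL z -> theta < z -> g < z ->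
  col g u v t -> col g u v t' -> t = t'.
Proof.
move=> hz tz gz; have [/= ci _ _] := centerP hz tz gz.
move=> [q [f [[l eu ev ->]|[l ev eu ->]]]] [q' [f' [[l' eu' ev' ->]|[l' ev' eu' ->]]]].
- by move: eu; rewrite eu' => /ci ->.
- by case: (lex_asym l l').
- by case: (lex_asym l l').
- by move: ev; rewrite ev' => /ci ->.
Qed.

Lemma edge_degree z g (u : lev z) : SL z -> theta < z -> g < z ->
  cle [set v | edge g u v] [set: lev g].
Proof.
move=> hz tz gz; have [/= ci _ _] := centerP hz tz gz.
exists (fun v f => exists2 q, u = @center z g q & v = @leaf z g q f); split.
  by move=> v [_ [q [f [eu ev]]]]; exists f => //; exists q.
by move=> v v' f _ _ [q -> ->] [q' /ci -> ->].
Qed.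

End Bernstein.

(** * The colouring by competing levels *)

Section Core.
Context {d : Order.disp_t} {K : orderType d}.
Hypothesis wK : well_order (<=%O : rel K).
Variables (theta : K) (t0 : seg theta) (Z : set K) (r : K -> K -> K).
Hypothesis nomax : forall a : K, exists b, a < b.
Hypothesis Z_SL : forall z, Z z -> SL z /\ theta < z.
Hypothesis r_lt : forall b z, Z z -> z <= b -> r b z < z /\ SL (r b z).
Hypothesis r_small : forall b g, SL g ->
  cle [set z | [/\ Z z, z <= b & r b z <= g]] (below g).
Implicit Types (a b c e g z : K) (F G : K -> bool).

Local Notation edge := (edge wK theta).
Local Notation col := (col wK).

Definition prior b z z' := r b z < r b z' \/ r b z = r b z' /\ z <= z'.

Definition pair_col b F G (t : seg theta) := exists z,
  [/\ Z z, z <= b, col (r b z) (res z F) (res z G) t &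
      forall z' (t' : seg theta), Z z' -> z' <= b -> col (r b z') (res z' F) (res z' G) t' ->
        prior b z z'].

Lemma pair_col_inj b F G t t' : pair_col b F G t -> pair_col b F G t' -> t = t'.
Proof.
move=> [z [Zz zb cz zP]] [z' [Zz' zb' cz' zP']].
have Ez : z = z'.
  move: (zP _ _ Zz' zb' cz') (zP' _ _ Zz zb cz); rewrite /prior.
  move=> [h|[E h]] [h'|[E' h']].
  - by move: (lt_trans h h'); rewrite ltxx.
  - by move: h; rewrite E' ltxx.
  - by move: h'; rewrite E ltxx.
  - by apply/eqP; rewrite eq_le h h'.
subst z'; have [hz tz] := Z_SL Zz; have [rz _] := r_lt Zz zb.
exact: col_inj hz tz rz cz cz'.
Qed.

Variable R : forall a : K, rel (lev a).
Hypothesis Rwo : forall a, well_order (@R a).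

(** [R] fixes the order in which the pair is listed; [t0] is the default when no level colours the
    pair. *)
Definition level_col b (s : nsubset 2 (lev b)) : seg theta :=
  @xget {classic (seg theta)} t0 [set t | exists u v,
    [/\ sval s = [set u; v], strict (@R b) u v & pair_col b (ext u) (ext v) t]].

Lemma level_colE b (s : nsubset 2 (lev b)) u v t :
  sval s = [set u; v] -> strict (@R b) u v -> pair_col b (ext u) (ext v) t ->
  level_col s = t.
Proof.
move=> Es uv ct; apply: (@xget_unique {classic (seg theta)}); first by exists u, v.
move=> t' [u' [v' [Es' uv' ct']]].
have : [set u'; v'] = [set u; v] by rewrite -Es.
move=> E.
have Hu : (u = u' \/ u = v') by have : [set u; v] u by [left]; rewrite -E.
have Hv : (v = u' \/ v = v') by have : [set u; v] v by [right]; rewrite -E.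
have nuv := uv.2; have [Ruv' nuv'] := uv'.
have [Eu Ev] : u = u' /\ v = v'.
  case: Hu Hv => Eu [] Ev; try by case: nuv; rewrite Eu Ev.
    by [].
  by case: nuv'; apply: (wo_anti (@Rwo b)) => //; rewrite -Eu -Ev; exact: uv.1.
by subst u' v'; exact: pair_col_inj ct' ct.
Qed.

(** * Realising two given colours inside a suitable tree *)

Section Tree.
Variables (T : forall a : K, set (lev a)) (A : set K).
Hypothesis sT : suitable T A.

Variables (z b : K).
Hypothesis (Zz : Z z) (zb : z <= b) (Az : cle (below z) (A `&` below z)).

Let g := r b z.
(** Any level that could beat [z] at [b] is in [W]. *)
Let W := [set w | [/\ Z w, w <= b & r b w <= g]].

Let hz : SL z. Proof. exact: (Z_SL Zz).1. Qed.
Let tz : theta < z. Proof. exact: (Z_SL Zz).2. Qed.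
Let gz : g < z. Proof. exact: (r_lt Zz zb).1. Qed.
Let hg : SL g. Proof. exact: (r_lt Zz zb).2. Qed.
Let cW : cle W (below g). Proof. exact: r_small. Qed.

(** [ext] puts leaves of different lengths into one set, so that a single diagonalisation avoids
    them all. *)
Definition early_edges (x : lev z) : set (K -> bool) :=
  [set f | exists2 w, W w & exists2 v, edge (r b w) (res w (ext x)) v & f = ext v].

(** There are at most [|g|] levels in [W], and each contributes one star with at most [2^g] leaves.
    The bound is uniform in [x], so the gap can be fixed before the centre is known. *)
Lemma early_edges_small : exists2 e, e < z & forall x, cle (early_edges x) (below e).
Proof.
have [c cz Hc] := hz.2 _ gz; have [e ez He] := SL_pair_lt hz cz.
exists e => // x; apply: cle_trans He; apply: cle_bigcup.
  exact: cle_trans cW (cle_below (ltW (lev_lt Hc))).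
move=> w [Zw wb rw]; have [hw tw] := Z_SL Zw; have [rww _] := r_lt Zw wb.
apply: cle_trans Hc; apply: cle_trans (cle_lev rw).
apply: cle_trans (edge_degree wK (res w (ext x)) hw tw rww).
exists (fun f v => f = ext v /\ edge (r b w) (res w (ext x)) v); split.
  by move=> f [v ev ->]; exists v.
by move=> f f' v _ _ [-> _] [-> _].
Qed.

(* The star of a level [w] has only [|lev (r b w)| <= |below g|] many leaves, so
   the union over the few [w] concerned does not exhaust [lev g]. *)
Lemma late_edges_avoid X (Y : lev g -> K -> bool) :
  (forall f f', res z (Y f) = res z (Y f') -> f = f') ->
  exists f, forall w, Z w -> w <= b -> z < w -> r b w < g ->
    ~ edge (r b w) (res w X) (res w (Y f)).
Proof.
move=> Yi; apply: contrapT => nex; apply: (@Cantor_lev _ _ g).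
pose F w := [set f | [/\ z < w, r b w < g & edge (r b w) (res w X) (res w (Y f))]].
apply: cle_subl (_ : _ `<=` [set f | exists2 w, W w & F w f]) _.
  move=> f _; apply: contrapT => nw; apply: nex; exists f => w Zw wb zw rw ew.
  by apply: nw; exists w => //; split=> //; exact: ltW.
apply: SL_bigcup => // w [Zw wb _].
have [hw tw] := Z_SL Zw; have [rww _] := r_lt Zw wb.
have [rg|rg] := pselect (r b w < g); last first.
  by exists (fun _ _ => False); split=> // f [_ /rg].
apply: cle_trans (SL_lev hg rg).
apply: cle_trans (edge_degree wK (res w X) hw tw rww).
have [zw|zw] := pselect (z < w); last first.
  by exists (fun _ _ => False); split=> // f [/zw].
apply: (@cle_img _ _ _ _ (fun f => res w (Y f))); first by move=> f [].
move=> f f' _ _ /res_eqP E; apply: Yi; apply/res_eqP => x xz.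
by apply: E; exact: lt_trans zw.
Qed.

Section Splitting.
Variables (D D1 e : K) (h : lev D) (G0 : set K).
Hypothesis (Dz : D < z) (sD : is_succ D D1) (Th : forall i, T (snoc h i : lev D1)).
Hypothesis G0_gap : G0 `<=`
  [set a | [/\ A a, D < a, a < z & forall w, W w -> D < w -> a < w]].
Hypothesis (ez : e < z) (G0_small : cle G0 (below e)) (G0_large : cle (below e) G0).
Hypothesis early : forall x, cle (early_edges x) (below e).

Let D1z : D1 < z.
Proof. by have [c Dc cz] := SL_limit hz Dz; exact: le_lt_trans (sD.2 _ Dc) cz. Qed.

Lemma res_snoc F i : res D1 F = snoc h i ->
  F D = i /\ forall x, x < D -> F x = ext h x.
Proof.
pose H x := if x < D then ext h x else i.
have HD : H D = i by rewrite /H ltxx.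
have Eh : h = res D H.
  by rewrite -[LHS]res_ext; apply/res_eqP => x xD; rewrite /H xD.
rewrite {1}Eh (snoc_res sD HD) => /res_eqP E; split.
  by rewrite E ?HD //; exact: sD.1.
by move=> x xD; rewrite E ?/H ?xD //; exact: lt_trans xD sD.1.
Qed.

Lemma lex_snoc F G : res D1 F = snoc h false -> res D1 G = snoc h true -> lex F G.
Proof.
move=> /res_snoc[FD Fh] /res_snoc[GD Gh]; exists D; split=> // t tD.
by rewrite Fh // Gh.
Qed.

Definition node_ok a (u v : lev a) :=
  [/\ T u, T v, D1 <= a -> res D1 (ext u) = snoc h false,
      D1 <= a -> res D1 (ext v) = snoc h true &
      Z a -> r b a <= g -> ~ edge (r b a) u v].

Definition tree_req (t01 t10 : seg theta) : Req theta z :=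
  (fun n => `[< node_ok (projT2 n).1 (projT2 n).2 >], (t01, t10)).

Lemma tree_reqP t01 t10 (x y : lev z) : Good (tree_req t01 t10) x y <->
  forall a, a < z -> node_ok (res a (ext x)) (res a (ext y)).
Proof.
split=> [H a az|H s]; last by apply/asboolP; exact: H (svalP s).
exact/asboolP/(H (exist _ a az)).
Qed.

(** The levels of [A] after [D] are divided: those in [G0] are spent on leaving the early edges at
    [F], and the remaining [|z|] many are free and produce [2^z] leaves. *)
Lemma tree_req_leaves t01 t10 F : (forall a, T (res a F)) -> res D1 F = snoc h false ->
  cle [set: lev z] [set y | Good (tree_req t01 t10) (res z F) y].
Proof.
move=> TF FD.
(* [F0] differs from every early edge somewhere on [G0]; the branch [G] below copies it there. *)
have [F0 F0P] := diagonal_avoid (cle_trans (early (res z F)) G0_large).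
apply: (cle_lev_prescribed (large_remainder wK hz ez Dz G0_small Az)).
  by move=> a [].
move=> Phi.
have [G [GD TG GA]] := branch wK nomax (fun a => if `[< G0 a >] then F0 a else Phi a)
  sT (Th true).
exists G; last first.
  move=> a [Aa Da az nG0]; rewrite GA //; last exact: sD.2.
  by case: asboolP.
apply/tree_reqP => a az; rewrite !res_res ?(ltW az) //; split=> //.
- by move=> /res_res ->.
- by move=> /res_res ->.
(* Up to [D] the branches [F] and [G] agree, which contradicts the lexicographic clause of an
   edge. *)
move=> Za ra ea; case: (leP a D) => [aD|Da].
  have [s [_ Fs Gs]] := ea.1; have sa := ext_out Gs.
  have sD' := lt_le_trans sa aD.
  move: Fs Gs; rewrite !ext_res // (res_snoc FD).2 // (res_snoc GD).2 // => ->.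
  by [].
have Wa : W a by split=> //; exact: le_trans (ltW az) zb.
have [|a' G0a'] := F0P (ext (res a G)).
  by exists a => //; exists (res a G) => //; rewrite res_res ?(ltW az).
(* [G0] lies before the next level of [W] after [D], so the difference at [a'] is already visible in
   the restriction to [a]. *)
have [Aa' Da' _ /(_ _ Wa Da) a'a] := G0_gap G0a'.
rewrite ext_res // GA //; last exact: sD.2.
by case: asboolP.
Qed.

Lemma tree_req_rich t01 t10 : rich (tree_req t01 t10).
Proof.
apply: (cle_lev_prescribed (large_remainder wK hz ez Dz G0_small Az)).
  by move=> a [].
move=> Phi; have [G [GD TG GA]] := branch wK nomax Phi sT (Th false).
exists G; first exact: tree_req_leaves.
by move=> a [Aa Da _ _]; apply: GA => //; exact: sD.2.
Qed.

Lemma node_limit (x : lev z) : (forall a, a < z -> T (res a (ext x))) -> T x.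
Proof.
move=> H; have [_ [_ _ Tlim] _] := sT; apply: Tlim; first exact: SL_is_limit.
by move=> a az; rewrite restrE; exact: H.
Qed.

(** [X] and [Y] prolong the centre and one leaf of the star attached to [tree_req t01 t10]. The
    requirement excludes competitors below [z], the choice of the leaf those above [z]. *)
Lemma splitting_pair t01 t10 : exists X Y, [/\ forall a, T (res a X), forall a, T (res a Y),
  res D1 X = snoc h false, res D1 Y = snoc h true &
  pair_col b X Y t01 /\ pair_col b Y X t10].
Proof.
have [/= ci li /(_ _ (tree_req_rich t01 t10)) GP] := centerP wK hz tz gz.
set q := tree_req t01 t10 in GP.
set x := center wK g q in GP.
set y := leaf wK q in GP.
have ok f a : a < z -> node_ok (res a (ext x)) (res a (ext (y f))).
  by move: a; apply/(tree_reqP t01 t10); exact: GP.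
have Tx : T x by apply: node_limit => a /(ok (fun=> true))[].
have Ty f : T (y f) by apply: node_limit => a /(ok f)[].
have [X Xx TX] := node_extend wK nomax sT Tx.
have /choice[Y YP] : forall f, exists G, res z G = y f /\ forall a, T (res a G).
  by move=> f; have [G] := node_extend wK nomax sT (Ty f); exists G.
have [f fP] : exists f, forall w, Z w -> w <= b -> z < w -> r b w < g ->
    ~ edge (r b w) (res w X) (res w (Y f)).
  by apply: late_edges_avoid => f f'; rewrite (YP f).1 (YP f').1 => /li.
have [Yy TY] := YP f.
have okE a : a < z -> node_ok (res a X) (res a (Y f)).
  move=> az; have := ok f a az.
  by rewrite -Xx -Yy !res_res ?(ltW az).
have [_ _ /(_ (lexx _)) + /(_ (lexx _)) + _] := okE _ D1z.
rewrite !res_res // => XD YD.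
have lXY := lex_snoc XD YD.
have ezz : lex (ext x) (ext (y f)).
  apply: lex_snoc.
    by rewrite -Xx res_res ?(ltW D1z).
  by rewrite -Yy res_res ?(ltW D1z).
have pri w : Z w -> w <= b -> edge (r b w) (res w X) (res w (Y f)) -> prior b z w.
  move=> Zw wb ew; rewrite /prior -/g.
  case: (ltgtP g (r b w)) => [rg|rg|rg]; [by left| |].
    case: (ltgtP w z) => wz.
    - by have [_ _ _ _ /(_ Zw (ltW rg))] := okE _ wz.
    - by case: (fP w Zw wb wz rg).
    - by move: rg; rewrite wz ltxx.
  right; split=> //; rewrite leNgt; apply/negP => wz.
  by have [_ _ _ _ /(_ Zw)] := okE _ wz; rewrite rg lexx => /(_ isT).
(* Edges ascend lexicographically and [X] precedes [Y f], so only edges from [X] to [Y f] compete,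
   whichever way the pair is listed. *)
have noYX w : ~ edge (r b w) (res w (Y f)) (res w X).
  by move=> [/lex_res lYX _]; exact: lex_asym lXY lYX.
exists X, (Y f); split=> //; split; exists z; split=> //.
- by rewrite Xx Yy; exists q, f; left.
- by move=> w t' Zw wb /col_edge[|/noYX//]; exact: pri.
- by rewrite Xx Yy; exists q, f; right.
- by move=> w t' Zw wb /col_edge[/noYX//|]; exact: pri.
Qed.

End Splitting.

(** The splitting node comes before the colours in the quantifiers, because the omitted colours
    depend on its two successors. *)
Lemma tree_pair : exists D D1 (h : lev D), [/\ D1 < z, is_succ D D1,
  forall i, T (snoc h i : lev D1) &
  forall t01 t10, exists X Y, [/\ forall a, T (res a X), forall a, T (res a Y),
    res D1 X = snoc h false, res D1 Y = snoc h true &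
    pair_col b X Y t01 /\ pair_col b Y X t10]].
Proof.
have [e ez early] := early_edges_small.
have [D [AD Dz cG]] := large_gap wK hz gz ez cW Az.
(* The gap is cut down to exactly the size of [below e]: enough levels to diagonalise, few enough to
   leave [|z|] levels of [A]. *)
have [G0 [G0s G0l G0b]] := cle_image cG.
have [_ [[[a0 [f0 Tf0]] _] _ _] TA] := sT.
have [H _ TH] := node_extend wK nomax sT Tf0.
have [D1 sD Th] := (TA _ _ (TH D)).2 AD.
exists D, D1, (res D H); split=> //.
  by have [c Dc cz] := SL_limit hz Dz; exact: le_lt_trans (sD.2 _ Dc) cz.
move=> t01 t10; exact: splitting_pair Dz sD Th G0s ez G0b G0l early t01 t10.
Qed.

End Tree.
End Core.

(** * From coloured pairs to the failure of [HLplus] *)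

Lemma card_set2 (X : Type) (u v : X) : u <> v -> [set u; v] #= `I_2.
Proof.
move=> uv; pose f n := if n is 0%N then u else v.
have -> : [set u; v] = f @` `I_2.
  apply/seteqP; split=> [x [->|->]|x [[|[|//]] _ <-]]; [by exists 0%N|by exists 1%N| |];
  by [left|right].
by apply: inj_card_eq => -[|[|m]] [|[|n]]; rewrite !inE //= => _ _ /esym // /esym.
Qed.

(** Each enumeration of the two successors of the splitting node has its own omitted colour. One
    pair of branches carries these two colours in its two orders, so an omitted colour occurs
    however [R b] orders the pair. *)
Lemma HLplus_fails (d : Order.disp_t) (K : orderType d)
    (wK : well_order (<=%O : rel K)) (theta : K) (t0 : seg theta)
    (Z : set K) (r : K -> K -> K) :
  (forall a : K, exists b, a < b) ->
  (forall c : K, ~ cle [set: K] (below c)) ->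
  (forall z, Z z -> SL z /\ theta < z) ->
  (forall A : set K, (forall c : K, ~ cle A (below c)) ->
    exists2 z, Z z & cle (below z) (A `&` below z)) ->
  (forall b z, Z z -> z <= b -> r b z < z /\ SL (r b z)) ->
  (forall b g, SL g -> cle [set z | [/\ Z z, z <= b & r b z <= g]] (below g)) ->
  ~ HLplus K 2 (seg theta).
Proof.
move=> nomax cardK Z_SL Z_large r_lt r_small HL.
pose R (a : K) : rel (lev a) := sval (well_ordering_principle {classic (lev a)}).
have Rwo a : well_order (R a) by exact: svalP.
have [T [A [sT HT]]] := HL R Rwo (fun b s => level_col wK t0 Z r R s).
have cA (c : K) : ~ cle A (below c).
  have [/card_eqPle[_ /cleP KA] _ _] := sT.
  by move=> /(cle_trans KA); exact: cardK.
have [z Zz Az] := Z_large A cA.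
have [b Ab zb] : exists2 b, A b & z <= b.
  apply: contrapT => nb; apply: (cA z); apply: cle_sub => x Ax /=.
  by rewrite /below /= ltNge; apply/negP => zx; apply: nb; exists x.
have [D [D1 [h [D1z sD Th pairs]]]] :=
  tree_pair wK nomax Z_SL r_lt r_small sT Zz zb Az.
have D1b := lt_le_trans D1z zb.
have nh : snoc h false <> snoc h true :> lev D1.
  have [X [Y [_ _ XD YD _]]] := pairs t0 t0; rewrite -XD -YD => /res_eqP.
  move=> /(_ _ sD.1); rewrite (res_snoc sD XD).1 (res_snoc sD YD).1.
  by [].
have omit (i : bool) : exists t : seg theta, forall u v : lev b, T b u -> T b v ->
    init_seg (snoc h i : lev D1) u -> init_seg (snoc h (~~ i) : lev D1) v ->
    strict (R b) u v -> ~ pair_col wK Z r b (ext u) (ext v) t.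
  pose eta (l : 'I_2) : lev D1 := snoc h (if l == ord0 then i else ~~ i).
  have [||t tP] := HT D1 eta.
  - by move=> l; exact: Th.
  - have ord2 (l m : 'I_2) : (l == ord0) = (m == ord0) -> l = m.
      by case: l m => [[|[|//]] ?] [[|[|//]] ?] // _; apply: val_inj.
    move=> l m; rewrite /eta => E; apply: ord2.
    by move: E; case: (l == ord0); case: (m == ord0); case: i {eta} => // /esym ?; case: nh.
  exists t => u v Tu Tv hu hv uv cuv.
  pose s : nsubset 2 (lev b) := exist _ [set u; v] (card_set2 uv.2).
  have Es : level_col wK t0 Z r R s = t by apply: (level_colE _ _ _ _ _ uv cuv).
  apply: (tP b (fun l => if l == ord0 then u else v) Ab _ _ s _ Es).
  - by move=> l; rewrite /eta; case: (l == ord0); split.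
  - by move=> [[|[|//]] ?] [[|[|//]] ?].
  - apply/seteqP; split=> [x [->|->]|x [l _ <-]].
    + by exists ord0.
    + by exists (lift ord0 ord0).
    + by case: (l == ord0); [left|right].
have [t01 H01] := omit false; have [t10 H10] := omit true.
have [X [Y [TX TY XD YD [c01 c10]]]] := pairs t01 t10.
have iX : init_seg (snoc h false : lev D1) (res b X) by exists (ltW D1b); rewrite restr_res.
have iY : init_seg (snoc h true : lev D1) (res b Y) by exists (ltW D1b); rewrite restr_res.
(* Only levels up to [b] compete, so cutting the branches at [b] keeps their colour. *)
have Eext t F G : pair_col wK Z r b F G t ->
    pair_col wK Z r b (ext (res b F)) (ext (res b G)) t.
  move=> [w [Zw wb cw wP]]; exists w; split=> //; first by rewrite !res_res.
  by move=> w' t' Zw' wb'; rewrite !res_res //; exact: wP.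
have [E|[uv|vu]] := wo_strict_total (Rwo b) (res b X) (res b Y).
- apply: nh; rewrite -XD -YD; apply/res_eqP => x xD1.
  by move/res_eqP: E; apply; exact: lt_trans D1b.
- by apply: (H01 _ _ (TX b) (TY b) iX iY uv); exact: Eext.
- by apply: (H10 _ _ (TY b) (TX b) iY iX vu); exact: Eext.
Qed.

(** * Closure points and regressive functions *)

Section Closure.
Context {d : Order.disp_t} {K : orderType d}.
Hypothesis wK : well_order (<=%O : rel K).
Implicit Types (a b c e g z : K) (P Q : K -> K -> Prop) (A B : set K).

(** For [pow_lt] these are the points of [SL], up to conversion; for [hits A] they are the limit
    points of [A]. *)
Definition clos P z := (exists x, x < z) /\ forall c, c < z -> exists2 e, e < z & P c e.

Definition mono P := forall c c' e e', c' <= c -> e <= e' -> P c e -> P c' e'.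

Definition pand P Q c e := P c e /\ Q c e.

Definition pow_lt c e := cle [set: lev c] (below e).

Definition hits A c e := exists x, [/\ A x, c < x & x <= e].

Lemma clos_sub P Q z : (forall c e, P c e -> Q c e) -> clos P z -> clos Q z.
Proof. by move=> PQ [? H]; split=> // c /H[e ez /PQ]; exists e. Qed.

Lemma clos_limit P z : (exists x, x < z) ->
  (forall c, c < z -> exists z', [/\ clos P z', c < z' & z' < z]) -> clos P z.
Proof.
move=> z0 H; split=> // c /H[z' [[_ Hz'] /Hz'[e ez' Pce] z'z]].
by exists e => //; exact: lt_trans z'z.
Qed.

Lemma mono_pand P Q : mono P -> mono Q -> mono (pand P Q).
Proof. by move=> mP mQ c c' e e' h h' [p q]; split; [exact: mP p|exact: mQ q]. Qed.

Lemma mono_pow_lt : mono pow_lt.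
Proof.
move=> c c' e e' h h' H; apply: cle_trans (cle_lev h) _.
exact: cle_trans H (cle_below h').
Qed.

Lemma mono_hits A : mono (hits A).
Proof.
move=> c c' e e' h h' [x [Ax cx xe]]; exists x; split=> //.
  exact: le_lt_trans cx.
exact: le_trans h'.
Qed.

Lemma total_pand P Q : mono P -> mono Q ->
  (forall c, exists e, P c e) -> (forall c, exists e, Q c e) ->
  forall c, exists e, pand P Q c e.
Proof.
move=> mP mQ tP tQ c; have [e Pe] := tP c; have [e' Qe'] := tQ c.
exists (Order.max e e'); split.
  by apply: mP Pe => //; rewrite le_max lexx.
by apply: mQ Qe' => //; rewrite le_max lexx orbT.
Qed.

Lemma SL_infinite z : SL z -> infinite_set (below z).
Proof.
move=> hz; apply/infiniteP/cleP; have [x xz] := hz.1.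
have /choice[S SP] : forall c, exists e, c < z -> c < e < z.
  move=> c; have [cz|ncz] := pselect (c < z); last by exists c.
  by have [e ce ez] := SL_limit hz cz; exists e; rewrite ce ez.
have fz n : iter n S x < z by elim: n => [//|n /SP /andP[]].
have fS n : iter n S x < iter n.+1 S x by have /andP[] := SP _ (fz n).
have fm m k : iter m S x < iter (m + k.+1)%N S x.
  by elim: k => [|k IH]; [rewrite addn1|rewrite addnS; exact: lt_trans IH (fS _)].
apply: (@cle_img _ _ _ _ (fun n => iter n S x)) => [n _|m n _ _]; first exact: fz.
case: (ltngtP m n) => [mn|nm|->//] E.
  by have := fm m (n - m.+1)%N; rewrite -addSnnS subnKC // E ltxx.
by have := fm n (m - n.+1)%N; rewrite -addSnnS subnKC // E ltxx.
Qed.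

Section OmegaBounded.
Hypothesis nat_bounded : forall f : nat -> K, exists b, forall n, f n < b.

(** The supremum of [omega] iterations of a witness function for [P], started at [a], is a closure
    point. *)
Lemma clos_unbounded P : mono P -> (forall c, exists e, P c e) ->
  forall a, exists2 z, a < z & clos P z.
Proof.
move=> mP tP a.
have nomax c : exists e, c < e by have [b] := nat_bounded (fun=> c) => /(_ 0%N); exists b.
have /choice[S SP] : forall c, exists e, c < e /\ P c e.
  move=> c; have [e Pe] := tP c; have [e' ce'] := nomax c.
  exists (Order.max e e'); rewrite lt_max ce' orbT; split=> //.
  by apply: mP Pe => //; rewrite le_max lexx.
have [z fz zmin] := Kmin wK (nat_bounded (fun n => iter n S a)).
exists z; first exact: (fz 0%N).
split=> [|c cz]; first by exists a; exact: (fz 0%N).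
have [n cn] : exists n, c <= iter n S a.
  apply: contrapT => nn; have : z <= c.
    by apply: zmin => n; rewrite ltNge; apply/negP => h; apply: nn; exists n.
  by rewrite leNgt cz.
exists (iter n.+1 S a); first exact: fz.
exact: mP cn (lexx _) (SP _).2.
Qed.

(** Closure is also required under [PA], which makes [A] have at least [|c|] members below some
    [e < z] for each [c < z]. Since [z] is a strong limit, fewer than [|z|] members in all would
    contradict Cantor's theorem. *)
Lemma clos_large P a A : mono P -> (forall c, exists e, P c e) ->
  (forall z, a < z -> clos P z -> SL z) -> (forall c : K, ~ cle A (below c)) ->
  exists2 z, a < z /\ clos P z & cle (below z) (A `&` below z).
Proof.
move=> mP tP PSL nA.
pose PA c e := cle (below c) (A `&` below e).
have mA : mono PA.
  move=> c c' e e' h h' H; apply: cle_trans (cle_below h) _; apply: cle_trans H _.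
  by apply: cle_sub => x [Ax xe]; split=> //; exact: lt_le_trans h'.
have tA c : exists e, PA c e.
  apply: contrapT => ne; apply: (nA c); apply: cle_initial => // e Ae H.
  by apply: ne; exists e.
have [z az cz] := clos_unbounded (mono_pand mP mA) (total_pand mP mA tP tA) a.
have cPz : clos P z by apply: clos_sub cz => c e [].
have hz := PSL _ az cPz.
exists z => //; apply: contrapT => /(small_below wK)[c cz' Hc].
have [c' c'z Hc'] := hz.2 _ cz'.
have [e ez [_ He]] := cz.2 _ c'z.
apply: (@Cantor_lev _ _ c); apply: cle_trans Hc' _; apply: cle_trans He _.
by apply: cle_subl Hc => x [Ax xe]; split=> //; exact: lt_trans ez.
Qed.

End OmegaBounded.

(** Induction on [b]. For [b] in [Z], take a cofinal [B] of size at most [c < b] and a strong limit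
    [p] between [c] and [b]. Up to [p] the function for [p] is used; beyond it, functions for
    members of [B], raised to at least [p]. If [g < p], only the former counts; if [p <= g], at most
    [|g|] functions contribute at most [|g|] points each. *)
Lemma regressive_small (Z : set K) :
  (forall a, (exists x, x < a) ->
     (forall c, c < a -> exists z, [/\ Z z, c < z & z < a]) -> Z a) ->
  (forall z, Z z -> exists B, [/\ B `<=` below z,
     forall x, x < z -> exists2 y, B y & x <= y & ~ cle (below z) B]) ->
  (forall z c, Z z -> c < z -> exists g, [/\ SL g, c < g & g < z]) ->
  forall b, exists r : K -> K,
    (forall z, Z z -> z <= b -> r z < z /\ SL (r z)) /\
    (forall g, SL g -> cle [set z | [/\ Z z, z <= b & r z <= g]] (below g)).
Proof.
move=> Zcl Zsing Zlim b; elim: (K_wf wK b) => {}b _ IH.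
have [Zb|nZb] := pselect (Z b); last first.
  have [[y yb yZ]|nex] := pselect (exists2 y, y < b & forall z, Z z -> z <= b -> z <= y).
    have [r [r1 r2]] := IH _ yb; exists r; split.
      by move=> z Zz zb; apply: r1 => //; exact: yZ.
    by move=> g hg; apply: cle_subl (r2 g hg) => z [Zz zb rz]; split=> //; exact: yZ.
  (* As [Z] is closed and omits [b], the lack of a bound below [b] forces [b] to be zero. *)
  have nb : ~ exists x, x < b.
    move=> b0; apply: (nZb); apply: Zcl => // c cb; apply: contrapT => nz.
    apply: nex; exists c => // z Zz zb; rewrite leNgt; apply/negP => cz; apply: nz.
    exists z; split=> //; rewrite lt_neqAle zb andbT; apply/eqP => E.
    by apply: nZb; rewrite -E.
  exists id; split=> [z Zz|g hg].
    rewrite le_eqVlt => /orP[/eqP E|zb]; last by case: nb; exists z.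
    by case: nZb; rewrite -E.
  exists (fun _ _ => False); split=> // z [Zz + _].
  rewrite le_eqVlt => /orP[/eqP E|zb]; last by case: nb; exists z.
  by case: nZb; rewrite -E.
have [B [Bb Bcof Bsmall]] := Zsing _ Zb.
have [c cb Bc] := small_below wK Bsmall.
have [p [hp cp pb]] := Zlim _ _ Zb cb.
have /choice[rr rrP] : forall y, exists r : K -> K, y < b ->
    (forall z, Z z -> z <= y -> r z < z /\ SL (r z)) /\
    (forall g, SL g -> cle [set z | [/\ Z z, z <= y & r z <= g]] (below g)).
  move=> y; have [yb|nyb] := pselect (y < b); last by exists id.
  by have [r rP] := IH _ yb; exists r.
have /choice[dd ddP] : forall z, exists y, z < b -> B y /\ z <= y.
  move=> z; have [zb|nzb] := pselect (z < b); last by exists z.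
  by have [y] := Bcof _ zb; exists y.
pose r z := if z <= p then rr p z else if z < b then Order.max p (rr (dd z) z) else p.
exists r; split.
  move=> z Zz zb; rewrite /r; case: (leP z p) => [zp|pz].
    exact: (rrP p pb).1.
  case: ifP => // zb'; have [By zy] := ddP _ zb'.
  have [h1 h2] := (rrP _ (Bb _ By)).1 _ Zz zy.
  by case: (leP p (rr (dd z) z)).
move=> g hg; case: (leP p g) => [pg|gp]; last first.
  apply: cle_subl ((rrP p pb).2 g hg) => z [Zz zb]; rewrite /r.
  case: (leP z p) => [zp //|pz].
  case: ifP => _; last by rewrite leNgt gp.
  by rewrite ge_max leNgt gp.
have c1 x : cle [set x] (below g).
  have [y yg] := hg.1; apply: (@cle_img _ _ _ _ (fun=> y)) => // ? ? -> ->//.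
pose F y := [set z | [/\ Z z, z <= y & rr y z <= g]].
apply: cle_subl (_ : _ `<=` (below p `|` ([set p] `|` [set b])) `|`
  [set z | exists2 y, B y & F y z]) _.
  move=> z [Zz zb rz]; case: (ltgtP z p) => zp; [by left; left| |by left; right; left].
  move: zb; rewrite le_eqVlt => /orP[/eqP ->|zb]; first by left; right; right.
  right; have [By zy] := ddP _ zb; exists (dd z) => //; split=> //.
  by move: rz; rewrite /r (leNgt z p) zp /= zb ge_max => /andP[].
apply: SL_setU => //.
  apply: SL_setU => //; first exact: cle_below.
  exact: SL_setU.
apply: SL_bigcup => //.
  by apply: cle_trans Bc (cle_below _); exact: le_trans (ltW cp) pg.
by move=> y By; apply: (rrP _ (Bb _ By)).2.
Qed.

End Closure.

(** * The inaccessible and the singular case *)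

Section Cases.
Context {d : Order.disp_t} {K : orderType d}.
Hypothesis wK : well_order (<=%O : rel K).
Implicit Types (a b c e g z : K) (A B C : set K).

Lemma cofinal_nat_bounded :
  (forall B, cofinal_in [set: K] B -> ~ cle B [set: nat]) ->
  forall f : nat -> K, exists b, forall n, f n < b.
Proof.
move=> H f; apply: contrapT => nb; apply: (H (range f)).
  split=> // x _; apply: contrapT => ny; apply: nb; exists x => n.
  by rewrite ltNge; apply/negP => xf; apply: ny; exists (f n) => //; exists n.
exists (fun y n => f n = y); split; first by move=> y [n _ <-]; exists n.
by move=> y y' n _ _ <- <-.
Qed.

Lemma strong_limit_pow : is_cardinal [set: K] -> strong_limit [set: K] ->
  forall c, exists e : K, pow_lt c e.
Proof.
move=> Kc Ks c.
(* [strong_limit] speaks of cardinals, so [c] is replaced by the least ordinal of its size. *)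
have [b cb bmin] := Kmin wK (ex_intro (fun b => cle (below c) (below b)) c (cle_refl _)).
have bc : is_cardinal (below b).
  move=> b' b'b; split; first by apply/cleP; exact: cle_below (ltW b'b).
  by move=> /cleP /(cle_trans cb) /bmin; rewrite leNgt b'b.
have [_ nK] := Ks b I bc.
have [|e _ He] := @small_below _ _ wK _ [set: K] [set: lev b].
  by move=> /cleP.
exists e; apply: cle_trans He; apply: cle_pow.
exact: cle_trans (cle_seg_below _) (cle_trans cb (cle_below_seg _)).
Qed.

Lemma cardinal_cle : is_cardinal [set: K] -> forall c, ~ cle [set: K] (below c).
Proof. by move=> Kc c /cleP; exact: (Kc c I).2. Qed.

Lemma SL_is_cardinal g : SL g -> is_cardinal (below g).
Proof.
move=> hg c cg; split; first by apply/cleP; exact: cle_below (ltW cg).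
by move=> /cleP; exact: SL_card.
Qed.

Lemma SL_strong_limit g : SL g -> strong_limit (below g).
Proof.
move=> hg c cg _; have [e eg He] := hg.2 _ cg; split.
  by apply/cleP; exact: SL_lev.
by move=> /cleP /cle_trans /(_ He); exact: SL_card.
Qed.

Section Inaccessible.
Hypothesis Kin : inaccessible [set: K].

Let Kc : is_cardinal [set: K]. Proof. by case: Kin => -[[]]. Qed.

Let Kpow : forall c, exists e : K, pow_lt c e.
Proof. by case: Kin => _ _; exact: strong_limit_pow. Qed.

Let Kbd : forall f : nat -> K, exists b, forall n, f n < b.
Proof.
apply: cofinal_nat_bounded => B cB BN; have [[_ [_ Kr]] Ku _] := Kin.
by apply: Ku; apply/cleP; apply: cle_trans BN; apply/cleP; exact: Kr.
Qed.

Let SL_above a : exists2 z, a < z & SL z.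
Proof. exact: (clos_unbounded wK Kbd mono_pow_lt Kpow a). Qed.

(** The strong limits above a strong limit [w] form a club. A regular one among them is uncountable,
    since it has at least [2^w] elements, and hence inaccessible. *)
Lemma first_inaccessible_not_Mahlo : (forall a : K, ~ inaccessible (below a)) -> ~ Mahlo K.
Proof.
move=> Kfirst [_ Kst].
have [x _] : exists x : K, True.
  apply: contrapT => nx; have [_ Ku _] := Kin; apply: Ku; apply/cleP.
  by exists (fun _ _ => False); split=> // x _; case: nx; exists x.
have [w _ hw] := SL_above x.
have [|a [ra [wa ha]]] := Kst [set a | w < a /\ SL a].
  split.
    split=> // y _; have [z yz hz] := SL_above (Order.max y w).
    move: yz; rewrite gt_max => /andP[yz wz]; exists z; last exact: ltW.
    by split.
  move=> a [[y ya] alim] [_ acof].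
  have H c : c < a -> exists z, [/\ w < z, SL z, c < z & z < a].
    move=> /alim[c' cc' c'a]; have [z [[wz hz] za] c'z] := acof _ c'a.
    by exists z; split=> //; exact: lt_le_trans c'z.
  split; first by have [z [wz _ _ za]] := H _ ya; exact: lt_trans za.
  apply: clos_limit; first by exists y.
  by move=> c /H[z [_ hz cz za]]; exists z.
apply: (Kfirst a); split=> //; last exact: SL_strong_limit.
move=> /cleP aN; apply: (@Cantor_lev _ _ w).
apply: cle_trans (SL_lev ha wa) _; apply: cle_trans aN _.
by apply/cleP/infiniteP; exact: SL_infinite.
Qed.

Lemma HLplus_fails_not_Mahlo (theta : K) : ~ Mahlo K -> (exists x, x < theta) ->
  ~ HLplus K 2 (seg theta).
Proof.
move=> nM [x0 x0t].
have [C [Ccof Ccl] Creg] : exists2 C : set K, club C &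
    forall x, C x -> ~ regular_cardinal (below x).
  apply: contrapT => nC; apply: nM; split=> // C cC; apply: contrapT => nx.
  by apply: nC; exists C => // x Cx rx; apply: nx; exists x.
(* Closure points are strong limits, limits of strong limits, and members of [C], hence singular:
   this is what [regressive_small] asks for. *)
pose P := pand pow_lt (pand (hits (@SL _ K)) (hits C)).
have mP : mono P.
  by apply: mono_pand; [exact: mono_pow_lt|apply: mono_pand; exact: mono_hits].
have nomax a : exists b, a < b by have [z az _] := SL_above a; exists z.
have tP : forall c, exists e, P c e.
  apply: total_pand => //; [exact: mono_pow_lt|apply: mono_pand; exact: mono_hits|].
  apply: total_pand; [exact: mono_hits|exact: mono_hits| |] => c.
    by have [z cz hz] := SL_above c; exists z, z.
  have [y cy] := nomax c; have [x Cx yx] := Ccof.2 y I.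
  by exists x, x; split=> //; exact: lt_le_trans yx.
pose Z z := theta < z /\ clos P z.
have ZSL z : clos P z -> SL z by apply: clos_sub => c e [].
have ZC z : clos P z -> C z.
  move=> hz; apply: Ccl; first exact: SL_is_limit (ZSL _ hz).
  split=> [x []//|x xz]; have [e ez [_ [_ [y [Cy xy ye]]]]] := hz.2 _ xz.
  by exists y; [split=> //; exact: le_lt_trans ez|exact: ltW].
have /choice[r rP] : forall b, exists r : K -> K,
    (forall z, Z z -> z <= b -> r z < z /\ SL (r z)) /\
    (forall g, SL g -> cle [set z | [/\ Z z, z <= b & r z <= g]] (below g)).
  apply: (regressive_small wK).
  - move=> a a0 H; split.
      by have [y ya] := a0; have [z [[tz _] _ za]] := H _ ya; exact: lt_trans za.
    by apply: clos_limit => // c /H[z [[_ hz] cz za]]; exists z.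
  - move=> z [tz hz]; have hz' := ZSL _ hz.
    have ncof : ~ cof_eq (below z) (below z).
      move=> hc; apply: (Creg z (ZC _ hz)); split=> //; split.
        exact: SL_is_cardinal.
      exact: SL_infinite.
    have [B [Bz Bc] nB] : exists2 B, cofinal_in (below z) B & ~ (below z #<= B).
      apply: contrapT => nB; apply: ncof; split.
        by exists (below z) => //; split=> // x xz; exists x.
      by move=> B cB; apply: contrapT => h; apply: nB; exists B.
    by exists B; split=> // /cleP.
  - move=> z c [_ hz] cz; have [e ez [_ [[g [hg cg ge]] _]]] := hz.2 _ cz.
    by exists g; split=> //; exact: le_lt_trans ez.
apply: (HLplus_fails wK (exist _ x0 x0t : seg theta) (Z := Z) (r := r)) => //.
- exact: cardinal_cle.
- by move=> z [tz /ZSL].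
- move=> A nA.
  have [z [tz hz] H] := clos_large wK Kbd (a := theta) mP tP (fun z _ => ZSL z) nA.
  by exists z.
- by move=> b; exact: (rP b).1.
- by move=> b; exact: (rP b).2.
Qed.

End Inaccessible.

Lemma HLplus_fails_singular (mu mu_plus : K) :
  infinite_cardinal [set: K] -> strong_limit [set: K] ->
  infinite_set (below mu) -> is_cardinal (below mu_plus) -> mu < mu_plus ->
  cof_eq [set: K] (below mu_plus) -> ~ HLplus K 2 (seg mu_plus).
Proof.
move=> [Kc _] Ks muinf mupc mum [[B [_ Bcof] /card_eqPle[/cleP BL _]] Lmin].
have Kpow := strong_limit_pow Kc Ks.
have Kbd : forall f : nat -> K, exists b, forall n, f n < b.
  (* A countable cofinal set would make [mu_plus] no larger than the infinite [mu]. *)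
  apply: cofinal_nat_bounded => B' cB' BN; apply: (mupc mu mum).2; apply/cleP.
  have /cleP LB := Lmin _ cB'; apply: cle_trans LB _; apply: cle_trans BN _.
  exact/cleP/infiniteP.
have nomax a : exists b, a < b by have [e /lev_lt ae] := Kpow a; exists e.
have [s ms hs] := clos_unbounded wK Kbd mono_pow_lt Kpow mu_plus.
pose P := pand pow_lt (hits B).
have mP : mono P by apply: mono_pand; [exact: mono_pow_lt|exact: mono_hits].
have tP : forall c, exists e, P c e.
  apply: total_pand => //; [exact: mono_pow_lt|exact: mono_hits|] => c.
  have [y cy] := nomax c; have [x Bx yx] := Bcof y I.
  by exists x, x; split=> //; exact: lt_le_trans yx.
pose Z z := s < z /\ clos P z.
have ZSL z : clos P z -> SL z by apply: clos_sub => c e [].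
apply: (HLplus_fails wK (exist _ mu mum : seg mu_plus) (Z := Z) (r := fun _ _ => s)) => //.
- exact: cardinal_cle.
- by move=> z [sz /ZSL]; split=> //; exact: lt_trans sz.
- move=> A nA.
  have [z [sz hz] H] := clos_large wK Kbd (a := s) mP tP (fun z _ => ZSL z) nA.
  by exists z.
- by move=> b z [sz _] _.
move=> b g hg; have [sg|gs] := leP s g; last first.
  by exists (fun _ _ => False); split=> // z [].
apply: cle_trans (_ : cle _ B) _; last first.
  by apply: cle_trans BL (cle_below _); exact: le_trans (ltW ms) sg.
(* Each [z] goes to the next member of [B]. This is injective because every larger closure point is
   a limit of [B], so a member of [B] lies between. *)
exists (fun z x => [/\ B x, z < x & forall y, B y -> z < y -> x <= y]); split.
  move=> z _; have [y zy] := nomax z; have [x Bx yx] := Bcof y I.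
  have [x' [Bx' zx'] xmin] := Kmin wK
    (ex_intro (fun x => B x /\ z < x) x (conj Bx (lt_le_trans zy yx))).
  by exists x' => //; split=> // y' By' zy'; apply: xmin.
have aux z z' x : clos P z' -> z < z' -> z' < x ->
    (forall y, B y -> z < y -> x <= y) -> False.
  move=> hz' zz' zx' xmin; have [e ez' [_ [y [By zy ye]]]] := hz'.2 _ zz'.
  have := xmin _ By zy; rewrite leNgt; apply/negP/negPn.
  exact: le_lt_trans ye (lt_trans ez' zx').
move=> z z' x [[_ hz] _ _] [[_ hz'] _ _] [Bx zx xm] [_ zx' xm'].
by case: (ltgtP z z') => // [zz'|z'z]; [case: (aux z z' x)|case: (aux z' z x)].
Qed.

End Cases.

Theorem theorem1p6 (d : Order.disp_t) (K : orderType d)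
    (wK : well_order (<=%O : rel K)) :
  [/\ first_inaccessible K ->
        forall theta : K, is_cardinal (below theta) -> `I_2 #<= below theta ->
          ~ HLplus K 2 (seg theta),
      inaccessible [set: K] -> ~ Mahlo K ->
        forall theta : K, is_cardinal (below theta) -> `I_2 #<= below theta ->
          ~ HLplus K 2 (seg theta)
    & singular_cardinal [set: K] -> strong_limit [set: K] ->
        forall mu mu_plus : K, regular_cardinal (below mu) ->
          is_succ_cardinal mu mu_plus -> cof_eq [set: K] (below mu_plus) ->
          ~ HLplus K 2 (seg mu_plus)].
Proof.
have I2 (theta : K) : `I_2 #<= below theta -> exists x, x < theta.
  by move=> /cleP[G [Gt _]]; have [//|x xt _] := Gt 0%N; exists x.
split.
- move=> [Kin Kfirst] theta _ /I2; apply: HLplus_fails_not_Mahlo => //.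
  exact: first_inaccessible_not_Mahlo.
- by move=> Kin nM theta _ /I2; exact: HLplus_fails_not_Mahlo.
- move=> [Kinf _] Ks mu mu_plus [[_ muinf] _] [mupc mum _].
  exact: (HLplus_fails_singular wK Kinf Ks muinf mupc mum).
Qed.
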